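(* Let $A\subset\mathbb R^n$ be such that $c_*(A)=\infty$ and $\mathcal E^+(A)$ is strongly closed, and let $\omega$ be a (signed) measure such that either (i) $\omega\in\mathcal E$, or (ii) $\omega^+$ is bounded, $U^\omega$ is upper semicontinuous on $\overline{A}$, $\sup_{x\in A}U^{|\omega|}(x)<\infty$, and $\lim_{|x|\to\infty,\ x\in\overline{A}}U^{\omega^-}(x)=0$. Put $f:=-U^\omega$. If the inner pseudo-balayage $\hat\omega^A$ of $\omega$ onto $A$ satisfies $\hat{\omega}^A(\mathbb R^n)<1$, then there is no measure minimizing $I_f(\mu)$ over $\mu\in\breve{\mathcal E}^+(A)$.
   Context: Let $n\geqslant2$, $0<\alpha<n$, and $\kappa_\alpha(x,y):=|x-y|^{\alpha-n}$ on $\mathbb R^n$. A measure is a real-valued (signed) Radon measure $\mu$ on $\mathbb R^n$ with Hahn--Jordan decomposition $\mu=\mu^+-\mu^-$ and $|\mu|:=\mu^++\mu^-$; $\mu$ is bounded if $|\mu|(\mathbb R^n)<\infty$. All measures considered are assumed to satisfy $\int_{|y|>1}|y|^{\alpha-n}\,d|\mu|(y)<\infty$. Potential: $U^\mu(x):=\int\kappa_\alpha(x,y)\,d\mu(y)$. Energy: $I(\mu):=\int\kappa_\alpha\,d(\mu\otimes\mu)$. $\mathcal E$ is the pre-Hilbert space of all measures of finite energy, with inner product $\langle\mu,\nu\rangle=\int\kappa_\alpha\,d(\mu\otimes\nu)$ and norm $\|\mu\|=\sqrt{I(\mu)}$; the norm topology is called strong. $\mathcal E^+$ is the cone of positive measures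 in $\mathcal E$. For $A\subset\mathbb R^n$ (not necessarily Borel), $\mathcal E^+(A)$ is the set of $\mu\in\mathcal E^+$ concentrated on $A$ (i.e. $\mathbb R^n\setminus A$ is $\mu$-negligible), and $\overline A$ is the closure of $A$ in $\mathbb R^n$. Inner capacity: $c_*(A):=\sup\{c(K):K\subset A\text{ compact}\}$, where $c(K):=1/\inf\{\|\mu\|^2:\mu\in\mathcal E^+(K),\ \mu(K)=1\}$ (with $\inf\varnothing=\infty$, $1/\infty=0$). For $f:=-U^\omega$: $\mathcal E^+_f(A)$ is the set of $\mu\in\mathcal E^+(A)$ for which $f$ is $\mu$-integrable; $I_f(\mu):=\|\mu\|^2+2\int f\,d\mu=\|\mu\|^2-2\int U^\omega\,d\mu$; the inner pseudo-balayage $\hat\omega^A$ is the measure minimizing $I_f$ over $\mathcal E^+_f(A)$; under the stated assumptions it exists and is unique. Further, $\breve{\mathcal E}^+(A):=\{\mu\in\mathcal E^+(A):\mu(\mathbb R^n)=1\}\subset\mathcal E^+_f(A)$. *)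

(* Defs.v *)
From HB Require Import structures.
From mathcomp Require Import all_boot all_order all_algebra.
From mathcomp Require Import all_classical all_reals all_analysis.

Set Implicit Arguments.
Unset Strict Implicit.
Unset Printing Implicit Defensive.

Import Order.TTheory GRing.Theory Num.Theory.
Import numFieldTopology.Exports numFieldNormedType.Exports.

Local Open Scope classical_set_scope.
Local Open Scope ring_scope.
Local Open Scope ereal_scope.

(* R^n with its usual topology and its Borel sigma-algebra. The norm that the
   library puts on row vectors is the sup norm, which gives the same topology;
   the Euclidean norm is [enorm]. *)
Definition Rn (R : realType) (n : nat) : Type := 'rV[R]_n.

HB.instance Definition _ (R : realType) (n : nat) :=
  PointedTopological.copy (Rn R n) 'rV[R]_n.
HB.instance Definition _ (R : realType) (n : nat) :=
  Measurable.copy (Rn R n) (g_sigma_algebraType (@open 'rV[R]_n)).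

Section Riesz.
Variables (R : realType) (n : nat).

Notation posmeas := {measure set (Rn R n) -> \bar R}.

Definition enorm (x : 'rV[R]_n) : R :=
  Num.sqrt (\sum_(i < n) x ord0 i ^+ 2)%R.

(* The case split is needed because [0 `^ r = 0] for r < 0 in the library. *)
Definition kappa (alpha : R) (x y : 'rV[R]_n) : \bar R :=
  if x == y then +oo else (enorm (x - y)%R `^ (alpha - n%:R))%:E.

(* On R^n every locally finite positive Borel measure is regular. *)
Definition radon (alpha : R) (mu : posmeas) : Prop :=
  (forall K : set (Rn R n), compact K -> mu K < +oo) /\
  \int[mu]_(y in [set y | (1 < enorm y)%R]) (enorm y `^ (alpha - n%:R))%:E
    < +oo.

(* A signed Radon measure, given by its Hahn-Jordan decomposition. It need not
   be bounded, so it is not a [charge] of the library. *)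
Record smeas (alpha : R) := SMeas {
  spos : posmeas ;
  sneg : posmeas ;
  spos_radon : radon alpha spos ;
  sneg_radon : radon alpha sneg ;
  smeas_singular : exists2 P : set (Rn R n), measurable P &
    spos (~` P) = 0 /\ sneg P = 0 }.

Definition tvar (alpha : R) (nu : smeas alpha) : posmeas :=
  measure_add (spos nu) (sneg nu).

Definition potential (alpha : R) (mu : posmeas) (x : Rn R n) : \bar R :=
  \int[mu]_y kappa alpha x y.

(* Where both terms are +oo, the potential is undefined in the theory, and
   equal to -oo here. *)
Definition spotential (alpha : R) (nu : smeas alpha) (x : Rn R n) : \bar R :=
  potential alpha (spos nu) x - potential alpha (sneg nu) x.

(* [\x] is the product measure when nu is sigma-finite, as every radon measure
   is. *)
Definition mutual (alpha : R) (mu nu : posmeas) : \bar R :=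
  \int[mu \x nu]_z kappa alpha z.1 z.2.

Definition energy (alpha : R) (mu : posmeas) : \bar R := mutual alpha mu mu.

(* The integral of the kernel against (p - q) (x) (p - q), where p and q need
   not be mutually singular. *)
Definition energyB (alpha : R) (p q : posmeas) : \bar R :=
  mutual alpha p p - mutual alpha p q - mutual alpha q p + mutual alpha q q.

(* The integral of a positive kernel against the signed measure
   nu (x) nu is finite iff the kernel is integrable against |nu| (x) |nu|. *)
Definition finite_energy (alpha : R) (nu : smeas alpha) : Prop :=
  energy alpha (tvar nu) < +oo.

Definition concentrated (A : set (Rn R n)) (mu : posmeas) : Prop :=
  mu.-negligible (~` A).

Definition Eplus (alpha : R) (A : set (Rn R n)) : set posmeas :=
  [set mu | [/\ radon alpha mu, energy alpha mu < +oo & concentrated A mu]].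

(* The strong norm of nu - mu = nu^+ - (nu^- + mu). *)
Definition strong_dist (alpha : R) (nu : smeas alpha) (mu : posmeas) : R :=
  Num.sqrt (fine (energyB alpha (spos nu) (measure_add (sneg nu) mu))).

(* Closedness, in the space of signed measures of finite energy, of a set of
   positive measures of finite energy. *)
Definition strongly_closed (alpha : R) (S : set posmeas) : Prop :=
  forall nu : smeas alpha, finite_energy nu ->
    (forall e : R, (0 < e)%R ->
       exists2 mu, S mu & (strong_dist nu mu < e)%R) ->
    sneg nu setT = 0 /\ S (spos nu).

Definition capacity (alpha : R) (K : set (Rn R n)) : \bar R :=
  (ereal_inf [set energy alpha mu |
     mu in [set mu | Eplus alpha K mu /\ mu K = 1]])^-1.

Definition inner_capacity (alpha : R) (A : set (Rn R n)) : \bar R :=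
  ereal_sup [set capacity alpha K | K in [set K | compact K /\ K `<=` A]].

Definition Eplus_f (alpha : R) (f : Rn R n -> \bar R) (A : set (Rn R n)) :
    set posmeas :=
  [set mu | Eplus alpha A mu /\ mu.-integrable setT f].

Definition Eplus1 (alpha : R) (A : set (Rn R n)) : set posmeas :=
  [set mu | Eplus alpha A mu /\ mu setT = 1].

Definition gauss (alpha : R) (f : Rn R n -> \bar R) (mu : posmeas) : \bar R :=
  energy alpha mu + 2%:E * \int[mu]_x f x.

Definition minimizer (T : Type) (F : T -> \bar R) (S : set T) (x : T) : Prop :=
  S x /\ forall y, S y -> F x <= F y.

(* The minimizer is unique under the assumptions of the theory, so this
   predicate determines it. *)
Definition pseudo_balayage (alpha : R) (om : smeas alpha) (A : set (Rn R n))
    (hom : posmeas) : Prop :=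
  let f := fun x => - spotential om x in
  minimizer (gauss alpha f) (Eplus_f alpha f A) hom.

(* In the topology of [subspace D], points outside D are isolated. *)
Definition usc_on (D : set (Rn R n)) (f : Rn R n -> \bar R) : Prop :=
  @lower_semicontinuous (subspace D) R (fun x => - f x).

(* The filter |x| -> oo. *)
Definition at_infinity : set_system (Rn R n) :=
  filter_from [set: R] (fun M => [set x | (M < enorm x)%R]).

Definition bounded_case (alpha : R) (om : smeas alpha) (A : set (Rn R n)) :
    Prop :=
  [/\ spos om setT < +oo,
      usc_on (closure A) (spotential om),
      ereal_sup [set potential alpha (tvar om) x | x in A] < +oo &
      potential alpha (sneg om) x @[x --> within (closure A) at_infinity]
        --> (0 : \bar R)].

End Riesz.

(* Main.v *)
Require Import Defs.
From HB Require Import structures.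
From mathcomp Require Import all_boot all_order all_algebra.
From mathcomp Require Import all_classical all_reals all_analysis measurable_realfun.
From mathcomp Require Import ring lra.

Set Implicit Arguments.
Unset Strict Implicit.
Unset Printing Implicit Defensive.

Import Order.TTheory GRing.Theory Num.Theory.
Import numFieldTopology.Exports numFieldNormedType.Exports.

Local Open Scope classical_set_scope.
Local Open Scope ring_scope.
Local Open Scope ereal_scope.

(** Write [hom] for the pseudo-balayage and suppose that [mu] minimizes the
    Gauss functional I_f over the probability measures in E^+(A).

    Since c_*(A) is infinite, A carries probability measures [tau] of
    arbitrarily small energy ([capacity_small_energy]). The probability measure
    hom + (1 - hom(R^n)) tau competes with [mu], and as the energy of [tau]
    tends to 0 its value of I_f gets no larger than I_f(hom) in the limit. Two
    facts are needed for that. The mutual energy of [tau] with a fixed measure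
    of finite energy tends to 0 ([mutual_small]). The integral of f against
    [tau] is at most that of U^{om^-}, which tends to 0 too
    ([sneg_integral_small]): in case (i) by the same estimate, in case (ii)
    because [tau] leaves every ball ([ball_mass_small]) while U^{om^-} is
    bounded on A and vanishes at infinity. Hence I_f(mu) <= I_f(hom).

    The measure (mu + hom) / 2 is admissible for the pseudo-balayage problem, so
    I_f(hom) is at most its value, and the parallelogram identity gives
    ||mu - hom||^2 <= 0. This is impossible, because two finite measures of
    different total masses are at positive distance ([energy_strict]).

    That last fact is the only part of the energy principle that is needed, and
    it is proved without Fourier analysis. The Riesz kernel is a mixture of
    Gaussians: with s = (n - alpha) / 2,
      C |x - y|^(alpha - n) = int_R e^(s u) exp(- e^u |x - y|^2) du
    ([kappa_mixture]). A Gaussian is positive definite because, by the power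
    series of exp(2 t x.y), it is a limit of sums of kernels phi(x) phi(y)
    ([gaussian_posdef]). When u tends to -oo the Gaussian tends to 1, so the
    Gaussian energy of mu - hom tends to (mu(R^n) - hom(R^n))^2, and a nonzero
    difference of masses makes the whole mixture positive. *)

(** * Sigma-finite measures and their products *)

Section as_sigma_finite.
Context d (T : measurableType d) (R : realType).
Variable mu : {measure set T -> \bar R}.
Hypothesis muoo : sigma_finite setT mu.

(** A copy of a measure, so that sigma-finiteness, which is a theorem about Radon
    measures, can be attached to it as an instance. *)
Definition as_sigma_finite of sigma_finite setT mu : set T -> \bar R := mu.

HB.instance Definition _ := Measure.on (as_sigma_finite muoo).
HB.instance Definition _ :=
  @Measure_isSigmaFinite.Build _ _ _ (as_sigma_finite muoo) muoo.

Lemma sigma_finite_measure_ex :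
  exists nu : {sigma_finite_measure set T -> \bar R}, nu = mu :> (set T -> \bar R).
Proof. by exists (as_sigma_finite muoo). Qed.

End as_sigma_finite.

Lemma sigma_finite_product d (T : measurableType d) (R : realType)
    (p q : {sigma_finite_measure set T -> \bar R}) : sigma_finite setT (p \x q).
Proof.
have /sigma_finiteP[F [TF ndF Foo]] := sigma_finiteT p.
have /sigma_finiteP[G [TG ndG Goo]] := sigma_finiteT q.
exists (fun k => F k `*` G k).
  apply/seteqP; split => // -[x y] _.
  have : [set: T] x by []. rewrite {1}TF => -[i _ Fx].
  have : [set: T] y by []. rewrite {1}TG => -[j _ Gy].
  exists (maxn i j) => //; split => /=.
  - by move: x Fx; exact/subsetPset/ndF/leq_maxl.
  - by move: y Gy; exact/subsetPset/ndG/leq_maxr.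
move=> k; have [mF Fk] := Foo k; have [mG Gk] := Goo k.
split; first exact: measurableX.
by rewrite /= product_measure1E// lte_mul_pinfty// ge0_fin_numE.
Qed.

(** Tonelli's theorem is used between the line and T * T, so the product of two
    sigma-finite measures has to be a sigma-finite measure in its own right. *)
Lemma product_sigma_finite_ex d (T : measurableType d) (R : realType)
    (p q : {sigma_finite_measure set T -> \bar R}) :
  exists pq : {sigma_finite_measure set (T * T)%type -> \bar R},
    pq = p \x q :> (set (T * T) -> \bar R).
Proof. exact/sigma_finite_measure_ex/sigma_finite_product. Qed.

(** * Powers as mixtures of exponentials *)

Section gauss_mixture.
Context {R : realType}.
Notation leb := (@lebesgue_measure R).
Implicit Types s u v rho : R.

(** Integrated over u, this is Euler's integral for the Gamma function after the
    substitution t = e^u. In this variable the scaling of t is a translation of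
    u, so that only the translation invariance of Lebesgue measure is used. *)
Definition gaussian_mix s rho u : R := (expR (s * u) * expR (- (expR u * rho)))%R.

(** Gamma(s). *)
Definition mix_const s : R := fine (\int[leb]_u (gaussian_mix s 1 u)%:E).

Lemma gaussian_mix_gt0 s rho u : (0 < gaussian_mix s rho u)%R.
Proof. by rewrite mulr_gt0// expR_gt0. Qed.

Lemma continuous_gaussian_mix s rho : continuous (gaussian_mix s rho).
Proof.
move=> u; apply: cvgM.
  apply: (@continuous_comp _ _ _ (fun u : R => s * u)%R expR);
    last exact: continuous_expR.
  by apply: cvgM; [exact: cvg_cst|exact: cvg_id].
apply: (@continuous_comp _ _ _ (fun u : R => - (expR u * rho))%R expR);
  last exact: continuous_expR.
apply: cvgN; apply: cvgM; last exact: cvg_cst.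
exact: continuous_expR.
Qed.

Lemma measurable_gaussian_mix s rho : measurable_fun setT (EFin \o gaussian_mix s rho).
Proof.
apply/measurable_EFinP; apply: continuous_measurable_fun; exact: continuous_gaussian_mix.
Qed.

Lemma integral_translation (G : R -> R) v : continuous G -> (forall x, (0 <= G x)%R) ->
  \int[leb]_x (G x)%:E = \int[leb]_x (G (x + v)%R)%:E.
Proof.
move=> cG G0.
have dF (x : R^o) : is_derive x (1%R : R^o) (fun x : R^o => (x + v)%R : R^o) 1%R.
  by apply: is_derive_eq; rewrite addr0.
have dE : (fun x : R => (x + v)%R)^`()%classic = cst 1%R.
  by apply/funext => x; rewrite derive1E; apply: (@derive_val _ _ _ _ _ _ _ (dF x)).
rewrite (@increasing_ge0_integration_by_substitutionT R (fun x => (x + v)%R) G)//.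
- by apply: eq_integral => x _; rewrite dE/= mulr1.
- by move=> x y; rewrite ltrD2r.
- by rewrite dE; exact: cst_continuous.
- by rewrite dE; exact: is_cvg_cst.
- by rewrite dE; exact: is_cvg_cst.
- exact: cvg_addrr_Ny.
- exact: cvg_addrr.
Qed.

Lemma gaussian_mix_integral_gt0 s : 0 < \int[leb]_u (gaussian_mix s 1 u)%:E.
Proof.
apply: (@lt_le_trans _ _
  (\int[leb]_(u in `[0%R, 1%R]%classic) (expR (- `|s| - expR 1))%:E)).
  rewrite integral_cst//= lebesgue_measure_itv/= lte_fin ltr01.
  by rewrite -EFinB -EFinM lte_fin subr0 mulr1 expR_gt0.
apply: (@le_trans _ _ (\int[leb]_(u in `[0%R, 1%R]%classic) (gaussian_mix s 1 u)%:E)).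
  apply: ge0_le_integral => //.
  - by apply: measurable_funTS; exact: measurable_gaussian_mix.
  - move=> x /=; rewrite in_itv/= => /andP[x0 x1].
    rewrite lee_fin /gaussian_mix -expRD ler_expR mulr1 lerB//; last by rewrite ler_expR.
    have : (`|s * x| <= `|s|)%R by rewrite normrM ler_piMr// ger0_norm.
    by rewrite ler_norml => /andP[].
apply: ge0_subset_integral => //; first exact: measurable_gaussian_mix.
by move=> x _; rewrite lee_fin ltW// gaussian_mix_gt0.
Qed.

(** For u >= 0, e^u >= 1 + u^2 / 2 beats s u by any linear amount; for u <= 0 the
    factor e^(s u) decays. Both give the bound e^K e^(- c |u|). *)
Lemma gaussian_mix_integral_lty s : (0 < s)%R ->
  \int[leb]_u (gaussian_mix s 1 u)%:E < +oo.
Proof.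
move=> s0.
pose c := Num.min 1%R s.
have c0 : (0 < c)%R by rewrite lt_min ltr01 s0.
have cg : continuous (fun u : R => expR (- (c * `|u|)) : R).
  move=> u.
  apply: (@continuous_comp _ _ _ (fun u : R => - (c * `|u|))%R expR);
    last exact: continuous_expR.
  apply: cvgN; apply: cvgM; first exact: cvg_cst.
  exact: norm_continuous.
pose K := ((s + 1) ^+ 2 / 2)%R.
apply: (@le_lt_trans _ _ (\int[leb]_u ((expR K)%:E * (expR (- (c * `|u|)))%:E))).
  apply: ge0_le_integral => //.
  - by move=> x _; rewrite lee_fin ltW// gaussian_mix_gt0.
  - exact: measurable_gaussian_mix.
  - apply: emeasurable_funM; first exact: measurable_cst.
    by apply/measurable_EFinP; apply: continuous_measurable_fun.
  - move=> u _; rewrite -EFinM lee_fin /gaussian_mix -!expRD ler_expR mulr1.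
    have [u0|u0] := leP 0%R u.
      have := @expR_ge1Dxn R u 1 u0; rewrite (_ : 2`! = 2)%N // => H.
      have : (c * u <= u)%R by apply: ler_piMl => //; rewrite ge_min lexx.
      rewrite (ger0_norm u0).
      have : (0 <= (u - (s + 1)) ^+ 2)%R by exact: sqr_ge0.
      by rewrite /K; move: H; lra.
    rewrite (ltr0_norm u0).
    have : (c * u >= s * u)%R.
      by apply: ler_wnM2r; [exact: ltW|rewrite ge_min lexx orbT].
    have := expR_gt0 u.
    have : (0 <= K)%R by rewrite /K divr_ge0// sqr_ge0.
    lra.
rewrite ge0_integralZl//; last first.
  by apply/measurable_EFinP; apply: continuous_measurable_fun.
rewrite (@ge0_symfun_integralT R (fun u => expR (- (c * `|u|))))//; last first.
  by move=> x /=; rewrite normrN.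
rewrite muleA -EFinM; apply: lte_mul_pinfty => //.
have -> : [set x : R | (0 <= x)%R] = `[0%R, +oo[%classic by rewrite set_itvcy.
apply: (@le_lt_trans _ _ (\int[leb]_u ((c^-1)%:E * (exponential_pdf c u)%:E))).
  rewrite integral_mkcond; apply: ge0_le_integral => //.
  - by move=> x _; apply: erestrict_ge0 => y _; rewrite lee_fin.
  - apply/(measurable_restrictT _ _).1 => //.
    apply: measurable_funTS.
    by apply/measurable_EFinP; apply: continuous_measurable_fun.
  - apply: emeasurable_funM; first exact: measurable_cst.
    by apply/measurable_EFinP; exact: measurable_exponential_pdf.
  - move=> u _; rewrite /patch; case: ifPn => [|_].
      rewrite inE/= in_itv/= andbT => u0; rewrite exponential_pdfE// -EFinM lee_fin.
      by rewrite ger0_norm// mulrA mulVf ?gt_eqF// mul1r mulNr.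
    by rewrite -EFinM lee_fin mulr_ge0// ?invr_ge0 ?exponential_pdf_ge0// ltW.
rewrite ge0_integralZl//; last 3 first.
- by apply/measurable_EFinP; exact: measurable_exponential_pdf.
- by move=> u _; rewrite lee_fin exponential_pdf_ge0// ltW.
- by rewrite lee_fin invr_ge0 ltW.
by rewrite integral_exponential_pdf// mule1 ltry.
Qed.

Lemma mix_constE s : (0 < s)%R -> \int[leb]_u (gaussian_mix s 1 u)%:E = (mix_const s)%:E.
Proof.
move=> s0; rewrite fineK// ge0_fin_numE ?gaussian_mix_integral_lty//.
exact/ltW/gaussian_mix_integral_gt0.
Qed.

(** Translate by - ln rho. *)
Lemma gaussian_mix_integral s rho : (0 < s)%R -> (0 < rho)%R ->
  \int[leb]_u (gaussian_mix s rho u)%:E = (mix_const s * expR (- (s * ln rho)))%:E.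
Proof.
move=> s0 r0; rewrite (@integral_translation (gaussian_mix s rho) (- ln rho)%R).
- under eq_integral => u _.
    rewrite (_ : gaussian_mix _ _ _ =
      expR (- (s * ln rho)) * gaussian_mix s 1 u)%R; last first.
      rewrite /gaussian_mix mulr1 expRB lnK ?posrE// divfK ?gt_eqF//.
      by rewrite mulrDr mulrN expRD mulrA [(expR _ * expR (s * u))%R]mulrC.
    rewrite EFinM.
  over.
  rewrite ge0_integralZl//.
  + by rewrite mix_constE// -EFinM mulrC.
  + exact: measurable_gaussian_mix.
  + by move=> x _; rewrite lee_fin ltW// gaussian_mix_gt0.
- exact: continuous_gaussian_mix.
- by move=> x; rewrite ltW// gaussian_mix_gt0.
Qed.

Lemma gaussian_mix_integral0 s : (0 < s)%R -> \int[leb]_u (gaussian_mix s 0 u)%:E = +oo.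
Proof.
move=> s0; apply/eqP; rewrite -leye_eq.
apply: (@le_trans _ _ (\int[leb]_(u in `[0%R, +oo[%classic) 1%:E)).
  by rewrite integral_cst//= lebesgue_measure_itv/= ltry/= mul1e.
apply: (@le_trans _ _ (\int[leb]_(u in `[0%R, +oo[%classic) (gaussian_mix s 0 u)%:E)).
  apply: ge0_le_integral => //.
  - by apply: measurable_funTS; exact: measurable_gaussian_mix.
  - move=> u /=; rewrite in_itv/= andbT => u0.
    rewrite lee_fin /gaussian_mix mulr0 oppr0 expR0 mulr1 -expR0 ler_expR.
    by rewrite mulr_ge0// ltW.
apply: ge0_subset_integral => //; first exact: measurable_gaussian_mix.
by move=> x _; rewrite lee_fin ltW// gaussian_mix_gt0.
Qed.

End gauss_mixture.

(** * Limits of sums of separated kernels are positive definite *)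

Section posdef.
Context d (T : measurableType d) (R : realType).
Implicit Types p q : {sigma_finite_measure set T -> \bar R}.

Lemma integrable_indic_lty d' (U : measurableType d') (m : {measure set U -> \bar R})
    (D : set U) : measurable D -> m D < +oo -> m.-integrable setT (EFin \o \1_D).
Proof.
move=> mD mDoo; apply/integrableP; split.
  by apply/measurable_EFinP; exact: measurable_indic.
under eq_integral do rewrite /= ger0_norm//.
by rewrite integral_indic// setIT.
Qed.

Section separated.
Variables (D : set T) (f : T -> R).
Hypotheses (mD : measurable D) (mf : measurable_fun setT f)
  (fD : forall x, (`|f x| <= \1_D x)%R).

Lemma integrable_cut p : p D < +oo -> p.-integrable setT (EFin \o f).
Proof.
move=> pD; apply: (@le_integrable _ _ _ p setT measurableT _ (EFin \o \1_D)).
- exact/measurable_EFinP.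
- by move=> x _ /=; rewrite lee_fin (le_trans (fD x))// ler_norm.
- exact: integrable_indic_lty.
Qed.

Lemma measurable_separated : measurable_fun setT
  (fun z : T * T => (f z.1 * f z.2)%:E).
Proof.
apply/measurable_EFinP; apply: measurable_funM.
  exact: (measurableT_comp mf).
exact: (measurableT_comp mf).
Qed.

Lemma integrable_separated p q : p D < +oo -> q D < +oo ->
  (p \x q).-integrable setT (fun z : T * T => (f z.1 * f z.2)%:E).
Proof.
move=> pD qD.
have mDD : measurable (D `*` D) by exact: measurableX.
apply: (@le_integrable _ _ _ (p \x q) setT measurableT _ (EFin \o \1_(D `*` D))).
- exact: measurable_separated.
- move=> [x y] _ /=; rewrite lee_fin normrM.
  have -> : (\1_(D `*` D) (x, y) = \1_D x * \1_D y :> R)%R.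
    by rewrite !indicE in_setX/= -natrM mulnb.
  by apply: (le_trans (ler_pM _ _ (fD x) (fD y))) => //; rewrite ler_norm.
- apply: integrable_indic_lty => //.
  by rewrite /= product_measure1E// lte_mul_pinfty// ge0_fin_numE.
Qed.

Lemma integral_separated p q : p D < +oo -> q D < +oo ->
  \int[p \x q]_z (f z.1 * f z.2)%:E =
  (fine (\int[p]_x (f x)%:E) * fine (\int[q]_x (f x)%:E))%:E.
Proof.
move=> pD qD; rewrite -(integral12_prod_meas1 (integrable_separated pD qD)).
have fp : \int[p]_x (f x)%:E \is a fin_num.
  exact: integrable_fin_num (integrable_cut pD).
have fq : \int[q]_x (f x)%:E \is a fin_num.
  exact: integrable_fin_num (integrable_cut qD).
rewrite /fubini_F/= EFinM (fineK fp) -integralZr//; last exact: integrable_cut.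
apply: eq_integral => x _; rewrite (fineK fq).
under eq_integral do rewrite EFinM.
by rewrite integralZl//; exact: integrable_cut.
Qed.

End separated.

(** Against a product measure, a kernel phi(x) phi(y) integrates to a product of
    two numbers, for which the inequality is 2 a b <= a^2 + b^2. Bounding the sum
    of the squares of the phi_i bounds the kernels uniformly as well, by
    2 |phi(x) phi(y)| <= phi(x)^2 + phi(y)^2, and dominated convergence on the
    set D x D of finite measure passes the inequality to the limit. *)
Lemma posdef_limit p q (D : set T) (I : nat -> finType)
    (f : forall N, I N -> T -> R) (k : T * T -> R) :
  measurable D -> p D < +oo -> q D < +oo ->
  (forall N i, measurable_fun setT (f N i)) ->
  (forall N x, (\sum_i f N i x ^+ 2 <= \1_D x)%R) ->
  measurable_fun setT k ->
  (forall z, (fun N => \sum_i f N i z.1 * f N i z.2)%R @ \oo --> k z) ->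
  2%:E * \int[p \x q]_z (k z)%:E <=
  \int[p \x p]_z (k z)%:E + \int[q \x q]_z (k z)%:E.
Proof.
move=> mD pD qD mf fD mk cvk.
have mDD : measurable (D `*` D) by exact: measurableX.
have fD1 N i x : (`|f N i x| <= \1_D x)%R.
  have : (f N i x ^+ 2 <= \1_D x)%R.
    apply: le_trans (fD N x); rewrite (bigD1 i)//= lerDl.
    by apply: sumr_ge0 => j _; exact: sqr_ge0.
  rewrite indicE; case: (x \in D) => /=.
    by rewrite -real_normK ?num_real// expr_le1.
  rewrite (_ : 0%:R = 0 ^+ 2)%R ?expr0n//= => h.
  by rewrite normr_le0 -sqrf_eq0 eq_le h sqr_ge0.
pose F N (z : T * T) := (\sum_i f N i z.1 * f N i z.2)%R.
have mF N : measurable_fun setT (fun z => (F N z)%:E).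
  apply/measurable_EFinP; apply: measurable_sum => i; apply: measurable_funM.
    exact: (measurableT_comp (mf N i)).
  exact: (measurableT_comp (mf N i)).
have dF N z : (`|F N z| <= \1_(D `*` D) z)%R.
  case: z => x y; rewrite /F/=.
  have -> : (\1_(D `*` D) (x, y) = \1_D x * \1_D y :> R)%R.
    by rewrite !indicE in_setX/= -natrM mulnb.
  have [xD|xD] := boolP (x \in D); last first.
    rewrite big1 ?normr0 ?mulr_ge0// => i _.
    have := fD1 N i x; rewrite indicE (negbTE xD) normr_le0 => /eqP ->.
    by rewrite mul0r.
  have [yD|yD] := boolP (y \in D); last first.
    rewrite big1 ?normr0 ?mulr_ge0// => i _.
    have := fD1 N i y; rewrite indicE (negbTE yD) normr_le0 => /eqP ->.
    by rewrite mulr0.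
  rewrite !indicE xD yD mulr1.
  have Hx := fD N x; have Hy := fD N y; rewrite !indicE ?xD ?yD/= in Hx Hy.
  rewrite (le_trans (ler_norm_sum _ _ _))//.
  apply: (@le_trans _ _ (\sum_i (f N i x ^+ 2 + f N i y ^+ 2) / 2)%R).
    apply: ler_sum => i _; rewrite ler_norml; apply/andP; split.
      by have := sqr_ge0 (f N i x + f N i y)%R; lra.
    by have := sqr_ge0 (f N i x - f N i y)%R; lra.
  by rewrite -mulr_suml big_split/=; move: Hx Hy; lra.
pose m (a : {sigma_finite_measure set T -> \bar R}) N i :=
  fine (\int[a]_x (f N i x)%:E).
have lim (a b : {sigma_finite_measure set T -> \bar R}) :
    a D < +oo -> b D < +oo ->
    \int[a \x b]_z (k z)%:E \is a fin_num /\
    (fun N => \sum_i m a N i * m b N i)%R @ \oo --> fine (\int[a \x b]_z (k z)%:E).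
  move=> aD bD.
  have FE N : \int[a \x b]_z (F N z)%:E = (\sum_i m a N i * m b N i)%:E.
    under eq_integral do rewrite /F -sumEFin.
    rewrite integral_sum//.
      by rewrite -sumEFin; apply: eq_bigr => i _; exact: (integral_separated mD).
    by move=> i; exact: (integrable_separated mD).
  have [||||ik _] := @dominated_convergence _ _ _ (a \x b) setT measurableT
    (fun N z => (F N z)%:E) (fun z => (k z)%:E) (EFin \o \1_(D `*` D)) mF.
  - exact/measurable_EFinP.
  - apply: aeW => z _; apply: cvg_EFin; first exact: nearW.
    exact: cvk.
  - apply: integrable_indic_lty => //=.
    by rewrite product_measure1E// lte_mul_pinfty// ge0_fin_numE.
  - by apply: aeW => z N _; rewrite /= lee_fin.
  have kfin : \int[a \x b]_z (k z)%:E \is a fin_num by exact: integrable_fin_num.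
  rewrite (_ : [sequence _]_n = fun N => (\sum_i m a N i * m b N i)%:E); last first.
    by apply/funext => N; exact: FE.
  by rewrite -{1}(fineK kfin) => /fine_cvgP[_ h]; split.
have [fpq cpq] := lim p q pD qD.
have [fpp cpp] := lim p p pD pD.
have [fqq cqq] := lim q q qD qD.
rewrite -(fineK fpq) -(fineK fpp) -(fineK fqq) -EFinM -EFinD lee_fin.
have cl : (fun N => 2 * \sum_i m p N i * m q N i)%R @ \oo -->
    (2 * fine (\int[p \x q]_z (k z)%:E))%R by apply: cvgMl_tmp; exact: cpq.
have cr : (fun N => \sum_i m p N i * m p N i + \sum_i m q N i * m q N i)%R @ \oo -->
    (fine (\int[p \x p]_z (k z)%:E) + fine (\int[q \x q]_z (k z)%:E))%R.
  exact: cvgD.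
apply: (ler_cvg_to cl cr).
apply: nearW => N; rewrite -big_split/= mulr_sumr; apply: ler_sum => i _.
by have := sqr_ge0 (m p N i - m q N i)%R; lra.
Qed.

End posdef.

(** * Positive definiteness of the Gaussian kernels *)

Section gaussian.
Context {R : realType} {n : nat}.
Notation T := (Rn R n).
Implicit Types (p q : {sigma_finite_measure set T -> \bar R}) (t : R).

Definition sqdist (x y : 'rV[R]_n) : R := (\sum_(i < n) (x ord0 i - y ord0 i) ^+ 2)%R.

Definition gaussian t (z : T * T) : R := expR (- (t * sqdist z.1 z.2)).

(** The cut-off makes the integrals against infinite measures finite. *)
Definition cut_gaussian t (D : set T) (z : T * T) : R :=
  (\1_D z.1 * \1_D z.2 * gaussian t z)%R.

Lemma measurable_coord i : measurable_fun [set: T] (fun x : T => (x : 'rV[R]_n) ord0 i).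
Proof.
apply: (measurability _ (RGenOpens.measurableE R)).
move=> _ [_ [a [b ->] <-]]; rewrite setTI; apply: sub_sigma_algebra.
have /continuousP cf := @coord_continuous R 1 n ord0 i.
exact/cf/interval_open.
Qed.

Lemma sqdist_ge0 x y : (0 <= sqdist x y)%R.
Proof. by apply: sumr_ge0 => i _; exact: sqr_ge0. Qed.

Lemma sqdist_eq0 x y : (sqdist x y == 0)%R = (x == y).
Proof.
apply/eqP/eqP => [h|->]; last by rewrite /sqdist big1// => i _; rewrite subrr expr0n.
apply/matrixP => i j; rewrite ord1; apply/eqP; rewrite -subr_eq0 -sqrf_eq0.
move/eqP: h; rewrite psumr_eq0; last by move=> k _; exact: sqr_ge0.
by move/allP => /(_ j); rewrite mem_index_enum => /(_ isT).
Qed.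

Lemma measurable_sqdist : measurable_fun [set: T * T] (fun z : T * T => sqdist z.1 z.2).
Proof.
apply: measurable_sum => i; apply: measurable_funX; apply: measurable_funB.
  exact: (measurableT_comp (measurable_coord i)).
exact: (measurableT_comp (measurable_coord i)).
Qed.

Lemma measurable_gaussian t : measurable_fun [set: T * T] (gaussian t).
Proof.
apply: (measurableT_comp (@measurable_expR R)).
apply: (measurableT_comp (@oppr_measurable R setT)).
exact: (measurableT_comp (mulrl_measurable t) measurable_sqdist).
Qed.

Lemma measurable_cut_gaussian t D : measurable D ->
  measurable_fun [set: T * T] (cut_gaussian t D).
Proof.
move=> mD; apply: measurable_funM; last exact: measurable_gaussian.
apply: measurable_funM.
  exact: (measurableT_comp (@measurable_indic _ _ _ setT _ mD)).
exact: (measurableT_comp (@measurable_indic _ _ _ setT _ mD)).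
Qed.

Section cut.
Variables (t : R) (D : set T).
Hypotheses (t0 : (0 <= t)%R) (mD : measurable D).

Let dot (x y : 'rV[R]_n) : R := (\sum_(i < n) x ord0 i * y ord0 i)%R.

Let word N := {k : 'I_N & {ffun 'I_k -> 'I_n}}.

Let term N (i : word N) (x : T) : R :=
  (\1_D x * expR (- (t * dot x x)) * Num.sqrt ((2 * t) ^+ tag i / (tag i)`!%:R) *
   \prod_(j < tag i) (x : 'rV[R]_n) ord0 (tagged i j))%R.

(** exp(- t |x - y|^2) is exp(- t |x|^2) exp(- t |y|^2) exp(2 t x.y); expanding the
    N-th partial sum of the last factor, (x.y)^k is the sum over the words w of
    length k of the products of x_(w j) y_(w j), hence separated. *)
Let sum_term N x y : (\sum_(i : word N) term i x * term i y =
  \1_D x * \1_D y * expR (- (t * (dot x x + dot y y))) *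
  series (exp_coeff (2 * t * dot x y)) N)%R.
Proof.
rewrite /series/= big_mkord mulr_sumr.
transitivity (\sum_(k < N) \sum_(w : {ffun 'I_k -> 'I_n})
   term (Tagged (fun k : 'I_N => {ffun 'I_k -> 'I_n}) w) x *
   term (Tagged (fun k : 'I_N => {ffun 'I_k -> 'I_n}) w) y)%R.
  rewrite (@sig_big_dep _ _ _ 'I_N (fun k : 'I_N => {ffun 'I_k -> 'I_n}) predT
   (fun _ => predT) (fun k (w : {ffun 'I_k -> 'I_n}) =>
   term (Tagged (fun k : 'I_N => {ffun 'I_k -> 'I_n}) w) x *
   term (Tagged (fun k : 'I_N => {ffun 'I_k -> 'I_n}) w) y))%R.
  by apply: eq_bigr => -[].
apply: eq_bigr => k _.
rewrite /exp_coeff/= exprMn.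
have -> : (dot x y ^+ k = \sum_(w : {ffun 'I_k -> 'I_n})
    \prod_(j < k) (x ord0 (w j) * y ord0 (w j)))%R.
  rewrite -(bigA_distr_bigA (fun (j : 'I_k) i => x ord0 i * y ord0 i)%R).
  by rewrite prodr_const card_ord.
have sq : (Num.sqrt ((2 * t) ^+ k / k`!%:R) * Num.sqrt ((2 * t) ^+ k / k`!%:R) =
    (2 * t) ^+ k / k`!%:R :> R)%R.
  by rewrite -expr2 sqr_sqrtr// divr_ge0// exprn_ge0// mulr_ge0.
rewrite [((2 * t) ^+ k * _ / _)%R]mulrAC -sq mulr_sumr mulr_sumr; apply: eq_bigr => w _.
rewrite /term/= big_split/= mulrDr opprD expRD.
ring.
Qed.

Let exp_partial (a : R) N : (0 <= a -> series (exp_coeff a) N <= expR a)%R.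
Proof.
move=> a0; apply: nondecreasing_cvgn_le.
  apply/nondecreasing_seqP => m; rewrite !seriesEnat/= big_nat_recr//= lerDl.
  exact: exp_coeff_ge0.
exact: is_cvg_series_exp_coeff.
Qed.

Let measurable_term N (i : word N) : measurable_fun setT (term i).
Proof.
apply: measurable_funM; last first.
  apply: measurable_prod => j _.
  exact: measurable_coord.
apply: measurable_funM; last exact: measurable_cst.
apply: measurable_funM; first exact: measurable_indic.
apply: (measurableT_comp (@measurable_expR R)).
apply: (measurableT_comp (@oppr_measurable R setT)).
apply: (measurableT_comp (mulrl_measurable t)).
apply: measurable_sum => k; apply: measurable_funM; exact: measurable_coord.
Qed.

Let dot_sqdist x y : (sqdist x y = dot x x + dot y y - 2 * dot x y)%R.
Proof.
rewrite /sqdist /dot mulr_sumr -big_split -sumrB; apply: eq_bigr => i _ /=.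
ring.
Qed.

(** On the diagonal, the partial sums are at most
    exp(- 2 t |x|^2) exp(2 t |x|^2) = 1: this is the bound on the squares. *)
Lemma gaussian_posdef_cut p q : p D < +oo -> q D < +oo ->
  2%:E * \int[p \x q]_z (cut_gaussian t D z)%:E <=
  \int[p \x p]_z (cut_gaussian t D z)%:E +
  \int[q \x q]_z (cut_gaussian t D z)%:E.
Proof.
move=> pD qD.
apply: (@posdef_limit _ _ _ p q D _ term) => //.
- move=> N x.
  under eq_bigr do rewrite expr2.
  rewrite sum_term.
  have := @exp_partial (2 * t * dot x x)%R N.
  have d0 : (0 <= dot x x)%R by apply: sumr_ge0 => i _; rewrite -expr2 sqr_ge0.
  rewrite !mulr_ge0// => /(_ isT) h.
  rewrite indicE; case: (x \in D); last by rewrite !mul0r.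
  rewrite !mul1r/=.
  apply: (@le_trans _ _ (expR (- (t * (dot x x + dot x x))) * expR (2 * t * dot x x))%R).
    by rewrite ler_pM2l; [exact: h|exact: expR_gt0].
  rewrite -expRD (_ : (_ + _ = 0)%R) ?expR0//; ring.
- exact: measurable_cut_gaussian.
- move=> [x y] /=.
  under eq_fun do rewrite sum_term.
  rewrite /cut_gaussian /gaussian/= (_ : expR _ =
     expR (- (t * (dot x x + dot y y))) * expR (2 * t * dot x y))%R; last first.
    rewrite -expRD dot_sqdist; congr expR; ring.
  rewrite mulrA; apply: cvgMl_tmp.
  exact: is_cvg_series_exp_coeff.
Qed.

End cut.

(** Exhaust the space by sets of finite measure for both p and q. *)
Lemma gaussian_posdef t p q : (0 <= t)%R ->
  2%:E * \int[p \x q]_z (gaussian t z)%:E <=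
  \int[p \x p]_z (gaussian t z)%:E + \int[q \x q]_z (gaussian t z)%:E.
Proof.
move=> t0.
have /sigma_finiteP[F [TF ndF Foo]] := sigma_finiteT p.
have /sigma_finiteP[G [TG ndG Goo]] := sigma_finiteT q.
pose D k := F k `&` G k.
have mD k : measurable (D k).
  by apply: measurableI; [have [] := Foo k|have [] := Goo k].
have pD k : p (D k) < +oo.
  have [mF] := Foo k; apply: le_lt_trans.
  by apply: le_measure; rewrite ?inE//; exact: subIsetl.
have qD k : q (D k) < +oo.
  have [mG] := Goo k; apply: le_lt_trans.
  by apply: le_measure; rewrite ?inE//; exact: subIsetr.
have Dtrue x : \forall k \near \oo, D k x.
  have : [set: T] x by []. rewrite {1}TF => -[i _ Fx].
  have : [set: T] x by []. rewrite {1}TG => -[j _ Gx].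
  exists (maxn i j) => // k /=; rewrite geq_max => /andP[ik jk]; split.
  - by move: x Fx {Gx}; exact/subsetPset/ndF.
  - by move: x Gx {Fx}; exact/subsetPset/ndG.
have g0 z : (0 <= gaussian t z)%R by exact: expR_ge0.
have c_le k z : (cut_gaussian t (D k) z <= gaussian t z)%R.
  by rewrite ler_piMl// mulr_ile1// indicE lern1 leq_b1.
have c_ge0 k z : (0 <= cut_gaussian t (D k) z)%R by rewrite !mulr_ge0.
have cvg_cut : (fun k => \int[p \x q]_z (cut_gaussian t (D k) z)%:E) @ \oo -->
    \int[p \x q]_z (gaussian t z)%:E.
  rewrite [X in _ --> X](_ : _ = \int[p \x q]_z
      (fun z => limn (fun k => (cut_gaussian t (D k) z)%:E)) z).
    apply: cvg_monotone_convergence => //.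
    - by move=> k; apply/measurable_EFinP; exact: measurable_cut_gaussian.
    - by move=> k z _; rewrite lee_fin.
    - move=> [x y] _ i j ij; rewrite lee_fin ler_wpM2r// ler_pM//=.
      + rewrite !indicE ler_nat; case: (boolP (x \in D i)) => //.
        rewrite inE => -[Fx Gx]; rewrite mem_set//; split.
          by move: x Fx {Gx}; exact/subsetPset/ndF.
        by move: x Gx {Fx}; exact/subsetPset/ndG.
      + rewrite !indicE ler_nat; case: (boolP (y \in D i)) => //.
        rewrite inE => -[Fx Gx]; rewrite mem_set//; split.
          by move: y Fx {Gx}; exact/subsetPset/ndF.
        by move: y Gx {Fx}; exact/subsetPset/ndG.
  apply: eq_integral => -[x y] _; apply/esym/cvg_lim => //.
  apply: cvg_near_cst; near=> k.
  rewrite /cut_gaussian/= !indicE !mem_set ?mul1r//.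
  - by near: k; exact: Dtrue.
  - by near: k; exact: Dtrue.
have : (fun k => 2%:E * \int[p \x q]_z (cut_gaussian t (D k) z)%:E) @ \oo -->
    2%:E * \int[p \x q]_z (gaussian t z)%:E.
  by apply: cvgeZl.
move=> /cvg_lim <- //.
apply: lime_le.
  by apply/cvg_ex; eexists; apply: cvgeZl cvg_cut.
apply: nearW => k.
apply: (le_trans (gaussian_posdef_cut t0 (mD k) (pD k) (qD k))).
apply: leeD; apply: ge0_le_integral => //.
- by move=> z _; rewrite lee_fin.
- by apply/measurable_EFinP; exact: measurable_cut_gaussian.
- by apply/measurable_EFinP; exact: measurable_gaussian.
- by move=> z _; rewrite lee_fin.
- by move=> z _; rewrite lee_fin.
- by apply/measurable_EFinP; exact: measurable_cut_gaussian.
- by apply/measurable_EFinP; exact: measurable_gaussian.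
- by move=> z _; rewrite lee_fin.
Unshelve. all: by end_near. Qed.

End gaussian.

(** * The energy of the Riesz kernel *)

Section energy.
Context {R : realType} {n : nat}.
Variable alpha : R.
Hypothesis alpha_ltn : (alpha < n%:R)%R.
Notation T := (Rn R n).
Notation leb := (@lebesgue_measure R).
Implicit Types (p q : {sigma_finite_measure set T -> \bar R}) (t : R).

Let s : R := ((n%:R - alpha) / 2)%R.

Let s0 : (0 < s)%R. Proof. by rewrite divr_gt0// subr_gt0. Qed.

Let C : R := mix_const s.

Let C0 : (0 < C)%R.
Proof. by rewrite -lte_fin -mix_constE// gaussian_mix_integral_gt0. Qed.

Let kap (z : T * T) : \bar R := kappa alpha z.1 z.2.

Let mix (v : (T * T) * R) : R := gaussian_mix s (sqdist v.1.1 v.1.2) v.2.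

Lemma kappa_ge0 (x y : T) : 0 <= kappa alpha x y.
Proof. by rewrite /kappa; case: ifP => // _; rewrite lee_fin powR_ge0. Qed.

Lemma kappa_sym (x y : T) : kappa alpha x y = kappa alpha y x.
Proof.
have -> : kappa alpha y x = if x == y then +oo
    else (enorm ((x : 'rV[R]_n) - y) `^ (alpha - n%:R))%:E; last by [].
rewrite /kappa eq_sym (_ : enorm (y - x) = enorm (x - y))//.
rewrite /enorm; congr Num.sqrt; apply: eq_bigr => i _.
by rewrite -sqrrN !mxE opprB.
Qed.

(** On the diagonal both sides are infinite, the integrand being e^(s u) there. *)
Lemma kappa_mixture (z : T * T) : \int[leb]_u (mix (z, u))%:E = C%:E * kap z.
Proof.
rewrite /mix/kap/kappa/=.
have [->|xy] := eqVneq z.1 z.2.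
  have /eqP -> : (sqdist z.2 z.2 == 0)%R by rewrite sqdist_eq0.
  by rewrite gaussian_mix_integral0// gt0_muley.
have r0 : (0 < sqdist z.1 z.2)%R by rewrite lt_neqAle sqdist_ge0 eq_sym sqdist_eq0 xy.
rewrite gaussian_mix_integral// -EFinM; congr (_ * _)%:E.
have -> : enorm ((z.1 : 'rV[R]_n) - z.2)%R = Num.sqrt (sqdist z.1 z.2).
  by rewrite /enorm /sqdist; congr Num.sqrt; apply: eq_bigr => i _; rewrite !mxE.
rewrite -powR12_sqrt ?ltW// -powRrM /powR gt_eqF//; congr expR.
by rewrite /s; field.
Qed.

Lemma measurable_mix : measurable_fun setT mix.
Proof.
apply: measurable_funM.
  apply: (measurableT_comp (@measurable_expR R)).
  exact: (measurableT_comp (mulrl_measurable s)).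
apply: (measurableT_comp (@measurable_expR R)).
apply: (measurableT_comp (@oppr_measurable R setT)).
apply: measurable_funM.
  exact: (measurableT_comp (@measurable_expR R)).
exact: (measurableT_comp measurable_sqdist).
Qed.

Lemma measurable_kappa : measurable_fun setT kap.
Proof.
have -> : kap = (fun z => C^-1%:E * \int[leb]_u (mix (z, u))%:E).
  apply/funext => z; rewrite kappa_mixture muleA -EFinM mulVf ?gt_eqF//.
  by rewrite mul1e.
apply: emeasurable_funM; first exact: measurable_cst.
apply: (@measurable_fun_fubini_tonelli_F _ _ _ _ R leb (EFin \o mix)).
- by apply/measurable_EFinP; exact: measurable_mix.
- by move=> v; rewrite /= lee_fin ltW// gaussian_mix_gt0.
Qed.

Definition gaussian_mutual p q u := \int[p \x q]_z (gaussian (expR u) z)%:E.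

Lemma gaussian_mutual_ge0 p q u : 0 <= gaussian_mutual p q u.
Proof. by apply: integral_ge0 => z _; rewrite lee_fin expR_ge0. Qed.

Lemma mix_gaussian z u : mix (z, u) = (expR (s * u) * gaussian (expR u) z)%R.
Proof. by []. Qed.

Lemma measurable_gaussian_mutual p q : measurable_fun setT (gaussian_mutual p q).
Proof.
have -> : gaussian_mutual p q = (fun u => (expR (- (s * u)))%:E *
    \int[p \x q]_z (mix (z, u))%:E).
  apply/funext => u; rewrite -ge0_integralZl//.
  - apply: eq_integral => z _; rewrite -EFinM mix_gaussian mulrA -expRD.
    by rewrite addNr expR0 mul1r.
  - by apply/measurable_EFinP; exact: (measurable_fun_pair1 u measurable_mix).
  - by move=> z _; rewrite lee_fin ltW// gaussian_mix_gt0.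
apply: emeasurable_funM.
  apply/measurable_EFinP; apply: (measurableT_comp (@measurable_expR R)).
  apply: (measurableT_comp (@oppr_measurable R setT)).
  exact: mulrl_measurable.
have [pq <-] := product_sigma_finite_ex p q.
apply: (@measurable_fun_fubini_tonelli_G _ _ _ _ R pq (EFin \o mix)).
- by apply/measurable_EFinP; exact: measurable_mix.
- by move=> v; rewrite /= lee_fin ltW// gaussian_mix_gt0.
Qed.

(** Tonelli's theorem, applied to the mixture. *)
Lemma mutual_mixture p q : C%:E * mutual alpha p q =
  \int[leb]_u ((expR (s * u))%:E * gaussian_mutual p q u).
Proof.
rewrite /mutual -ge0_integralZl//; last 3 first.
- exact: measurable_kappa.
- by move=> z _; exact: kappa_ge0.
- by rewrite lee_fin ltW.
transitivity (\int[p \x q]_z \int[leb]_u (EFin \o mix) (z, u)).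
  by apply: eq_integral => z _; rewrite /= kappa_mixture.
have [pq pqE] := product_sigma_finite_ex p q.
rewrite -pqE (@fubini_tonelli _ _ _ _ R pq leb (EFin \o mix)).
- apply: eq_integral => u _; rewrite /gaussian_mutual -pqE -ge0_integralZl//.
    by apply/measurable_EFinP; exact: measurable_gaussian.
  by move=> z _; rewrite lee_fin expR_ge0.
- by apply/measurable_EFinP; exact: measurable_mix.
- by move=> v; rewrite /= lee_fin ltW// gaussian_mix_gt0.
Qed.

Lemma mutual_ge0 p q : 0 <= mutual alpha p q.
Proof. by apply: integral_ge0 => z _; exact: kappa_ge0. Qed.

Let measurable_mixture p q :
  measurable_fun setT (fun u => (expR (s * u))%:E * gaussian_mutual p q u).
Proof.
apply: emeasurable_funM; last exact: measurable_gaussian_mutual.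
apply/measurable_EFinP; apply: (measurableT_comp (@measurable_expR R)).
exact: mulrl_measurable.
Qed.

(** The Gaussian inequality, integrated over the mixture. Both sides are sums of
    elements of [0, +oo], so that the inequality also gives the finiteness of the
    mutual energy of two measures of finite energy. *)
Lemma energy_cs p q :
  2%:E * mutual alpha p q <= mutual alpha p p + mutual alpha q q.
Proof.
rewrite -(@lee_pmul2l _ C%:E)// ?lte_fin//.
rewrite (ge0_muleDr _ (mutual_ge0 p p) (mutual_ge0 q q)) muleCA !mutual_mixture.
have nn a b u : 0 <= (expR (s * u))%:E * gaussian_mutual a b u.
  by rewrite mule_ge0// ?gaussian_mutual_ge0// lee_fin expR_ge0.
rewrite -(ge0_integralZl leb measurableT (measurable_mixture p q)
  (fun u _ => nn p q u)); last by rewrite lee_fin.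
rewrite -(ge0_integralD leb measurableT
  (fun u _ => nn p p u) (measurable_mixture p p)
  (fun u _ => nn q q u) (measurable_mixture q q)).
apply: ge0_le_integral => //.
- by move=> u _; rewrite mule_ge0.
- exact: measurable_funeM (measurable_mixture p q).
- exact: emeasurable_funD (measurable_mixture p p)
    (measurable_mixture q q).
- move=> u _.
  rewrite muleCA -(ge0_muleDr _ (gaussian_mutual_ge0 p p u) (gaussian_mutual_ge0 q q u)).
  by rewrite lee_wpmul2l// gaussian_posdef// expR_ge0.
Qed.

(** As u decreases to -oo the Gaussian increases to 1. *)
Let gaussian_mutual_homo p q u v : (u <= v)%R ->
  gaussian_mutual p q v <= gaussian_mutual p q u.
Proof.
move=> uv; apply: ge0_le_integral => //.
- by move=> z _; rewrite lee_fin expR_ge0.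
- by apply/measurable_EFinP; exact: measurable_gaussian.
- by apply/measurable_EFinP; exact: measurable_gaussian.
- move=> z _; rewrite lee_fin ler_expR lerN2 ler_wpM2r ?sqdist_ge0//.
  by rewrite ler_expR.
Qed.

Let gaussian_mutual_le p q u : gaussian_mutual p q u <= p setT * q setT.
Proof.
rewrite -product_measure1E// setXTT -[leRHS]mul1e -integral_cst//.
apply: ge0_le_integral => //.
- by move=> z _; rewrite lee_fin expR_ge0.
- by apply/measurable_EFinP; exact: measurable_gaussian.
- move=> z _; rewrite lee_fin /gaussian -expR0 ler_expR oppr_le0.
  by rewrite mulr_ge0// ?sqdist_ge0.
Qed.

Let gaussian_mutual_cvg p q :
  (fun k : nat => gaussian_mutual p q (- k%:R)%R) @ \oo --> p setT * q setT.
Proof.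
rewrite -product_measure1E// setXTT -[X in _ --> X]mul1e -integral_cst//.
rewrite [X in _ --> X](_ : _ = \int[p \x q]_z
   (fun z => limn (fun k : nat => (gaussian (expR (- k%:R)) z)%:E)) z).
  apply: cvg_monotone_convergence => //.
  - by move=> k; apply/measurable_EFinP; exact: measurable_gaussian.
  - by move=> k z _; rewrite lee_fin expR_ge0.
  - move=> z _ i j ij; rewrite lee_fin ler_expR lerN2 ler_wpM2r ?sqdist_ge0//.
    by rewrite ler_expR lerN2 ler_nat.
apply: eq_integral => z _; apply/esym/cvg_lim => //.
apply: cvg_EFin; first exact: nearW.
rewrite -[X in _ --> X](@expR0 R) -oppr0 -(mul0r (sqdist z.1 z.2)).
apply: (@cvg_comp _ _ _
  (fun k : nat => - (expR (- k%:R) * sqdist z.1 z.2))%R expR);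
  last exact: continuous_expR.
apply: cvgN; apply: cvgMr_tmp; exact: cvgn_expR.
Qed.

(** The gap is half of the limit (p(T) - q(T))^2. By monotonicity the bound at one
    integer persists for all smaller u: the energies of p and q increase, while
    the mutual energy stays below p(T) q(T). *)
Let gaussian_mutual_gap p q : p setT < +oo -> q setT < +oo -> p setT != q setT ->
  exists2 d : R, (0 < d)%R & exists k : nat, forall u : R, (u <= - k%:R)%R ->
    2%:E * gaussian_mutual p q u + d%:E <= gaussian_mutual p p u + gaussian_mutual q q u.
Proof.
move=> poo qoo pq.
have pfin : p setT \is a fin_num by rewrite ge0_fin_numE.
have qfin : q setT \is a fin_num by rewrite ge0_fin_numE.
pose a := fine (p setT); pose b := fine (q setT).
have aE : p setT = a%:E by rewrite fineK.
have bE : q setT = b%:E by rewrite fineK.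
have ab : (0 < (a - b) ^+ 2)%R.
  by rewrite exprn_even_gt0//= subr_eq0; move: pq; rewrite aE bE eqe.
exists ((a - b) ^+ 2 / 2)%R; first by rewrite divr_gt0.
have cvgS : (fun k : nat =>
    gaussian_mutual p p (- k%:R)%R + gaussian_mutual q q (- k%:R)%R) @ \oo -->
    (a * a + b * b)%:E.
  rewrite EFinD 2!EFinM -aE -bE; apply: cvgeD; last 2 first.
  - exact: gaussian_mutual_cvg.
  - exact: gaussian_mutual_cvg.
  - by rewrite aE bE -2!EFinM.
have lt : (2 * (a * b) + (a - b) ^+ 2 / 2)%:E < (a * a + b * b)%:E.
  by rewrite lte_fin; move: ab; lra.
have [k kP] : exists k : nat, (2 * (a * b) + (a - b) ^+ 2 / 2)%:E <
    gaussian_mutual p p (- k%:R)%R + gaussian_mutual q q (- k%:R)%R.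
  apply: contrapT => /forallNP noK.
  have : (a * a + b * b)%:E <= (2 * (a * b) + (a - b) ^+ 2 / 2)%:E.
    apply: (cvge_le _ cvgS); apply: nearW => k.
    by rewrite leNgt; apply/negP; exact: noK.
  by rewrite leNgt lt.
exists k => u uk.
have ule (p' q' : {sigma_finite_measure set T -> \bar R}) :=
  @gaussian_mutual_homo p' q' _ _ uk.
apply: le_trans (leeD (ule p p) (ule q q)).
apply: le_trans (ltW kP).
rewrite [leRHS]EFinD; apply: leeD => //; rewrite [leRHS]EFinM lee_pmul2l// EFinM -aE -bE.
exact: gaussian_mutual_le.
Qed.

(** The gap contributes a positive amount already on an interval of length one. *)
Lemma energy_strict p q : p setT < +oo -> q setT < +oo -> p setT != q setT ->
  mutual alpha p p < +oo -> mutual alpha q q < +oo ->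
  2%:E * mutual alpha p q < mutual alpha p p + mutual alpha q q.
Proof.
move=> poo qoo pq Ip Iq.
have [d d0 [k gap]] := gaussian_mutual_gap poo qoo pq.
pose I : set R := `[(- k%:R - 1)%R, (- k%:R)%R]%classic.
pose e := (expR (s * (- k%:R - 1)) * d)%R.
have e0 : (0 < e)%R by rewrite mulr_gt0// expR_gt0.
have fin (p' q' : {sigma_finite_measure set T -> \bar R}) :
    mutual alpha p' q' < +oo -> mutual alpha p' q' \is a fin_num.
  by move=> h; rewrite ge0_fin_numE// mutual_ge0.
have fp := fin p p Ip; have fq := fin q q Iq.
have fpq : mutual alpha p q \is a fin_num.
  apply: fin; have := energy_cs p q.
  rewrite -(fineK fp) -(fineK fq) -EFinD => /le_lt_trans /(_ (ltry _)).
  have := mutual_ge0 p q; case: (mutual alpha p q) => [r _ _||//]; first exact: ltry.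
  by move=> _; rewrite gt0_muley.
suff main : C%:E * (2%:E * mutual alpha p q) + e%:E <=
    C%:E * (mutual alpha p p + mutual alpha q q).
  move: main; rewrite -(fineK fp) -(fineK fq) -(fineK fpq) -EFinD -!EFinM -!EFinD.
  rewrite lee_fin lte_fin => main.
  by rewrite -(ltr_pM2l C0); apply: lt_le_trans main; rewrite ltrDl.
rewrite (ge0_muleDr _ (mutual_ge0 p p) (mutual_ge0 q q)) muleCA !mutual_mixture.
have nn a b u : 0 <= (expR (s * u))%:E * gaussian_mutual a b u.
  by rewrite mule_ge0// ?gaussian_mutual_ge0// lee_fin expR_ge0.
have mIset : measurable I by exact: measurable_itv.
have -> : e%:E = \int[leb]_u (e%:E * (\1_I u)%:E).
  rewrite ge0_integralZl//.
  - have -> : \int[leb]_u (\1_I u)%:E = leb I.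
      transitivity (leb (I `&` setT)); last by rewrite setIT.
      exact: integral_indic.
    rewrite lebesgue_measure_itv/= lte_fin.
    rewrite ltrBlDr ltrDl ltr01 -EFinB opprB addrCA subrr addr0.
    by rewrite mule1.
  - by apply/measurable_EFinP; exact: measurable_indic.
  - by rewrite lee_fin ltW.
rewrite -(ge0_integralZl leb measurableT (measurable_mixture p q)
  (fun u _ => nn p q u)); last by rewrite lee_fin.
rewrite -(ge0_integralD leb measurableT
  (fun u _ => nn p p u) (measurable_mixture p p)
  (fun u _ => nn q q u) (measurable_mixture q q)).
have mI : measurable_fun setT (fun u : R => e%:E * (\1_I u)%:E).
  by apply: measurable_funeM; apply/measurable_EFinP; exact: measurable_indic.
have nI u : 0 <= e%:E * (\1_I u)%:E by rewrite -EFinM lee_fin mulr_ge0// ltW.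
have m2 := measurable_funeM 2%:E (measurable_mixture p q).
have n2 u : 0 <= 2%:E * ((expR (s * u))%:E * gaussian_mutual p q u) by rewrite mule_ge0.
rewrite -(ge0_integralD leb measurableT (fun u _ => n2 u) m2 (fun u _ => nI u) mI).
apply: ge0_le_integral => //.
- by move=> u _; rewrite adde_ge0.
- exact: emeasurable_funD m2 mI.
- exact: emeasurable_funD (measurable_mixture p p)
    (measurable_mixture q q).
- move=> u _.
  rewrite muleCA -(ge0_muleDr _ (gaussian_mutual_ge0 p p u) (gaussian_mutual_ge0 q q u)).
  rewrite indicE; have [uI|uI] := boolP (u \in I); last first.
    by rewrite mule0 adde0 lee_wpmul2l ?gaussian_posdef ?expR_ge0// lee_fin expR_ge0.
  move: uI; rewrite inE /I/= in_itv/= => /andP[u1 u2].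
  apply: (@le_trans _ _ ((expR (s * u))%:E * (2%:E * gaussian_mutual p q u + d%:E))).
    rewrite (@ge0_muleDr _ _ (2%:E * gaussian_mutual p q u) d%:E)
      ?mule_ge0 ?gaussian_mutual_ge0 ?lee_fin ?(ltW d0)//.
    apply: leeD => //; rewrite mule1 -EFinM lee_fin /e ler_wpM2r ?(ltW d0)//.
    by rewrite ler_expR; apply: ler_wpM2l => //; exact: ltW.
  by rewrite lee_wpmul2l ?gap.
Qed.

End energy.

(** * Radon measures, potentials and conic combinations *)

Section radon_measures.
Context {R : realType} {n : nat}.
Variable alpha : R.
Hypothesis alpha_ltn : (alpha < n%:R)%R.
Notation T := (Rn R n).
Notation posmeas := {measure set T -> \bar R}.
Implicit Types mu nu : posmeas.

Lemma closed_measurable_Rn (D : set T) : closed D -> measurable D.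
Proof.
move=> cD; rewrite -(setCK D); apply: measurableC; apply: sub_sigma_algebra.
exact: closed_openC.
Qed.

Lemma compact_measurable_Rn (D : set T) : compact D -> measurable D.
Proof.
move=> /(compact_closed (@norm_hausdorff _ _)); exact: closed_measurable_Rn.
Qed.

Definition cube (k : R) : set T := [set x : T | (`|(x : 'rV[R]_n)| <= k)%R].

Lemma compact_cube k : compact (cube k).
Proof.
apply: bounded_closed_compact.
  exists k; split; first exact: num_real.
  by move=> M kM x /= xk; exact: (le_trans xk (ltW kM)).
apply: (@closed_comp _ _ (fun x : 'rV[R]_n => `|x|%R) [set r | r <= k]%R).
  by move=> x _; exact: norm_continuous.
exact: closed_le.
Qed.

(** The closed balls of the sup norm are compact. *)
Lemma radon_sigma_finite mu : radon alpha mu -> sigma_finite setT mu.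
Proof.
move=> [muK _]; exists (fun k : nat => cube k%:R).
  apply/seteqP; split => // x _.
  exists (Num.bound (`|(x : 'rV[R]_n)|)%R) => //.
  by rewrite /cube/= ltW// (le_lt_trans _ (archi_boundP _)).
move=> k; have ck := @compact_cube k%:R.
by split; [exact: compact_measurable_Rn|exact: muK].
Qed.

Lemma radon_rep mu : radon alpha mu ->
  exists p : {sigma_finite_measure set T -> \bar R}, p = mu :> (set T -> \bar R).
Proof. by move=> /radon_sigma_finite; exact: sigma_finite_measure_ex. Qed.

Lemma potential_ge0 mu x : 0 <= potential alpha mu x.
Proof. by apply: integral_ge0 => y _; exact: kappa_ge0. Qed.

Lemma measurable_kappa1 (x : T) : measurable_fun setT (fun y : T => kappa alpha x y).
Proof. exact: (measurable_fun_pair2 x (measurable_kappa alpha_ltn)). Qed.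

Lemma measurable_potential mu : radon alpha mu ->
  measurable_fun setT (potential alpha mu).
Proof.
move=> /radon_rep[p pE].
have := @measurable_fun_fubini_tonelli_F _ _ _ _ R p _ (measurable_kappa alpha_ltn).
by rewrite /fubini_F /potential -pE; apply=> z; exact: kappa_ge0.
Qed.

Lemma mutualE mu nu : radon alpha mu -> radon alpha nu ->
  mutual alpha mu nu = \int[mu]_x potential alpha nu x.
Proof.
move=> /radon_rep[p pE] /radon_rep[q qE].
rewrite /mutual /potential -pE -qE.
rewrite (@fubini_tonelli1 _ _ _ _ R p q _ (measurable_kappa alpha_ltn))//.
by move=> z; exact: kappa_ge0.
Qed.

Lemma mutualC mu nu : radon alpha mu -> radon alpha nu ->
  mutual alpha mu nu = mutual alpha nu mu.
Proof.
move=> rmu rnu; rewrite (mutualE rnu rmu).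
move: rmu rnu => /radon_rep[p pE] /radon_rep[q qE].
rewrite /mutual /potential -pE -qE.
have k0 (z : T * T) : 0 <= kappa alpha z.1 z.2 by exact: kappa_ge0.
apply: (etrans (@fubini_tonelli2 _ _ _ _ R p q _ (measurable_kappa alpha_ltn) k0)).
by apply: eq_integral => y _; apply: eq_integral => x _; exact: kappa_sym.
Qed.

Lemma mutual_cs mu nu : radon alpha mu -> radon alpha nu ->
  2%:E * mutual alpha mu nu <= energy alpha mu + energy alpha nu.
Proof.
move=> /radon_rep[p pE] /radon_rep[q qE].
have := energy_cs alpha_ltn p q.
by rewrite /energy /mutual -pE -qE.
Qed.

Lemma mutual_strict mu nu : radon alpha mu -> radon alpha nu ->
  mu setT < +oo -> nu setT < +oo -> mu setT != nu setT ->
  energy alpha mu < +oo -> energy alpha nu < +oo ->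
  2%:E * mutual alpha mu nu < energy alpha mu + energy alpha nu.
Proof.
move=> /radon_rep[p pE] /radon_rep[q qE].
have := @energy_strict _ _ _ alpha_ltn p q.
by rewrite /energy /mutual -pE -qE.
Qed.

Lemma mutual_nonneg mu nu : radon alpha mu -> radon alpha nu ->
  0 <= mutual alpha mu nu.
Proof.
by move=> rm rn; rewrite mutualE//; apply: integral_ge0 => x _; exact: potential_ge0.
Qed.

Lemma mutual_lty mu nu : radon alpha mu -> radon alpha nu ->
  energy alpha mu < +oo -> energy alpha nu < +oo -> mutual alpha mu nu < +oo.
Proof.
move=> rmu rnu Imu Inu; have := mutual_cs rmu rnu.
have : energy alpha mu + energy alpha nu < +oo by exact: lte_add_pinfty.
move=> /[swap] /le_lt_trans /[apply].
have := mutual_nonneg rmu rnu.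
case: (mutual alpha mu nu) => [r _ _||//]; first exact: ltry.
by move=> _; rewrite gt0_muley.
Qed.

Definition conic (a b : {nonneg R}) mu nu : posmeas :=
  measure_add (mscale a mu) (mscale b nu).

Lemma conicE (a b : {nonneg R}) mu nu A :
  conic a b mu nu A = a%:num%:E * mu A + b%:num%:E * nu A.
Proof. exact: measure_addE. Qed.

Lemma ge0_integral_conic (a b : {nonneg R}) mu nu (D : set T) f :
  measurable D -> (forall x, 0 <= f x) -> measurable_fun setT f ->
  \int[conic a b mu nu]_(x in D) f x =
  a%:num%:E * \int[mu]_(x in D) f x + b%:num%:E * \int[nu]_(x in D) f x.
Proof.
move=> mD f0 mf; have mfD := measurable_funTS mf : measurable_fun D f.
by rewrite /conic ge0_integral_measure_add// !ge0_integral_mscale.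
Qed.

Lemma conic_lty (a b : {nonneg R}) (x y : \bar R) : 0 <= x -> 0 <= y ->
  x < +oo -> y < +oo -> a%:num%:E * x + b%:num%:E * y < +oo.
Proof.
move=> x0 y0 xoo yoo; apply: lte_add_pinfty; apply: lte_mul_pinfty => //.
Qed.

Lemma measurable_enorm : measurable_fun [set: T] (fun x : T => enorm x).
Proof.
have -> : (fun x : T => enorm x) = (fun x : T => Num.sqrt (sqdist x 0)).
  apply/funext => x; rewrite /enorm /sqdist; congr Num.sqrt.
  by apply: eq_bigr => i _; rewrite mxE subr0.
apply: (measurableT_comp (continuous_measurable_fun (@sqrt_continuous R))).
exact: (measurable_fun_pair1 (0%R : T) measurable_sqdist).
Qed.

Lemma measurable_enorm_gt (r : R) : measurable [set x : T | (r < enorm x)%R].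
Proof.
have := measurable_enorm measurableT (measurable_itv `]r, +oo[%R).
rewrite setTI => h; apply: eq_ind h _ _; apply/seteqP.
by split => x /=; rewrite in_itv/= andbT.
Qed.

Lemma measurable_enorm_le (r : R) : measurable [set x : T | (enorm x <= r)%R].
Proof.
rewrite (_ : mkset _ = ~` [set x : T | (r < enorm x)%R]).
  by apply: measurableC; exact: measurable_enorm_gt.
by apply/seteqP; split => x /=; rewrite leNgt => /negP.
Qed.

Lemma radon_add mu nu : radon alpha mu -> radon alpha nu ->
  radon alpha (measure_add mu nu).
Proof.
move=> [mK mi] [nK ni]; split=> [K cK|].
  by rewrite [X in X < _](measure_addE mu nu K) lte_add_pinfty ?mK ?nK.
rewrite ge0_integral_measure_add//.
- exact: lte_add_pinfty.
- exact: measurable_enorm_gt.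
- by move=> x _; rewrite lee_fin powR_ge0.
- apply/measurable_EFinP; apply: measurable_funTS.
  by apply: (measurableT_comp (measurable_powR _)); exact: measurable_enorm.
Qed.

Lemma radon_scale (a : {nonneg R}) mu : radon alpha mu -> radon alpha (mscale a mu).
Proof.
move=> [mK mi]; split=> [K cK|].
  by rewrite /mscale/=; apply: lte_mul_pinfty => //; exact: mK.
rewrite ge0_integral_mscale//.
- by apply: lte_mul_pinfty.
- exact: measurable_enorm_gt.
- apply/measurable_EFinP; apply: measurable_funTS.
  by apply: (measurableT_comp (measurable_powR _)); exact: measurable_enorm.
- by move=> x _; rewrite lee_fin powR_ge0.
Qed.

Lemma radon_conic a b mu nu : radon alpha mu -> radon alpha nu ->
  radon alpha (conic a b mu nu).
Proof. by move=> rm rn; apply: radon_add; exact: radon_scale. Qed.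

Lemma concentrated_conic a b A mu nu : concentrated A mu -> concentrated A nu ->
  concentrated A (conic a b mu nu).
Proof.
move=> [B [mB B0 AB]] [C [mC C0 AC]]; exists (B `&` C); split.
- exact: measurableI.
- rewrite conicE.
  have -> : mu (B `&` C) = 0.
    apply: (subset_measure0 _ mB _ B0); first exact: measurableI.
    exact: subIsetl.
  have -> : nu (B `&` C) = 0.
    apply: (subset_measure0 _ mC _ C0); first exact: measurableI.
    exact: subIsetr.
  by rewrite !mule0 adde0.
- by move=> x Ax; split; [exact: AB|exact: AC].
Qed.

Lemma mutual_conicr a b mu nu1 nu2 : radon alpha mu -> radon alpha nu1 ->
  radon alpha nu2 ->
  mutual alpha mu (conic a b nu1 nu2) =
  a%:num%:E * mutual alpha mu nu1 + b%:num%:E * mutual alpha mu nu2.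
Proof.
move=> rm r1 r2.
have rc := radon_conic a b r1 r2.
rewrite (mutualC rm rc) (mutualC rm r1) (mutualC rm r2) !mutualE//.
by rewrite ge0_integral_conic//; [exact: potential_ge0|exact: measurable_potential].
Qed.

Lemma energy_conic a b mu nu : radon alpha mu -> radon alpha nu ->
  energy alpha mu < +oo -> energy alpha nu < +oo ->
  energy alpha (conic a b mu nu) =
  (a%:num ^+ 2 * fine (energy alpha mu) +
   2 * a%:num * b%:num * fine (mutual alpha mu nu) +
   b%:num ^+ 2 * fine (energy alpha nu))%:E.
Proof.
move=> rm rn Im In.
have fin (x : \bar R) : 0 <= x -> x < +oo -> x = (fine x)%:E.
  by move=> x0 xoo; rewrite fineK// ge0_fin_numE.
have rc := radon_conic a b rm rn.
rewrite /energy (mutual_conicr _ _ rc rm rn) (mutualC rc rm) (mutualC rc rn).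
rewrite !mutual_conicr// (mutualC rn rm) -/(energy alpha mu) -/(energy alpha nu).
rewrite (fin (energy alpha mu) (mutual_nonneg rm rm) Im).
rewrite (fin (energy alpha nu) (mutual_nonneg rn rn) In).
rewrite (fin _ (mutual_nonneg rm rn) (mutual_lty rm rn Im In)).
rewrite -!(EFinM, EFinD); congr _%:E; rewrite /energy/=.
ring.
Qed.

Lemma Eplus_conic a b A mu nu : Eplus alpha A mu -> Eplus alpha A nu ->
  Eplus alpha A (conic a b mu nu).
Proof.
move=> [rm Im cm] [rn In cn]; split.
- exact: radon_conic.
- by rewrite energy_conic// ltry.
- exact: concentrated_conic.
Qed.

Lemma integrable_conic a b mu nu f : mu.-integrable setT f ->
  nu.-integrable setT f -> (conic a b mu nu).-integrable setT f.
Proof.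
move=> /integrableP[mf fm] /integrableP[_ fn]; apply/integrableP; split => //.
rewrite ge0_integral_conic//; last exact: measurableT_comp.
by apply: conic_lty => //; exact: integral_ge0.
Qed.

Lemma integral_conic a b mu nu f : mu.-integrable setT f ->
  nu.-integrable setT f ->
  \int[conic a b mu nu]_x f x =
  (a%:num * fine (\int[mu]_x f x) + b%:num * fine (\int[nu]_x f x))%:E.
Proof.
move=> fm fn; have mf := measurable_int _ fm.
rewrite integralE !ge0_integral_conic//; last 2 first.
- exact: measurable_funeneg.
- exact: measurable_funepos.
have fin (x : \bar R) : x \is a fin_num -> x = (fine x)%:E by move=> /fineK.
rewrite [\int[mu]_x f x]integralE [\int[nu]_x f x]integralE.
have i1 := integrable_pos_fin_num measurableT fm.
have i2 := integrable_neg_fin_num measurableT fm.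
have i3 := integrable_pos_fin_num measurableT fn.
have i4 := integrable_neg_fin_num measurableT fn.
rewrite (fin _ i1) (fin _ i2) (fin _ i3) (fin _ i4) -!(EFinM, EFinD, EFinB) /=.
congr _%:E; ring.
Qed.

Lemma gauss_conic a b mu nu f : radon alpha mu -> radon alpha nu ->
  energy alpha mu < +oo -> energy alpha nu < +oo ->
  mu.-integrable setT f -> nu.-integrable setT f ->
  gauss alpha f (conic a b mu nu) =
  (a%:num ^+ 2 * fine (energy alpha mu) +
   2 * a%:num * b%:num * fine (mutual alpha mu nu) +
   b%:num ^+ 2 * fine (energy alpha nu) +
   2 * (a%:num * fine (\int[mu]_x f x) + b%:num * fine (\int[nu]_x f x)))%:E.
Proof.
by move=> rm rn Im In fm fn; rewrite /gauss energy_conic// integral_conic// -EFinM -EFinD.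
Qed.

Lemma gaussE mu f : radon alpha mu -> energy alpha mu < +oo -> mu.-integrable setT f ->
  gauss alpha f mu =
  (fine (energy alpha mu) + 2 * fine (\int[mu]_x f x))%:E.
Proof.
move=> rm Im fm; rewrite /gauss.
have fI : energy alpha mu \is a fin_num by rewrite ge0_fin_numE// mutual_nonneg.
have fF : \int[mu]_x f x \is a fin_num by exact: integrable_fin_num.
by rewrite -{1}(fineK fI) -{1}(fineK fF) -EFinM -EFinD.
Qed.

End radon_measures.

(** * Measures of small energy and the external field *)

Section small_energy.
Context {R : realType} {n : nat}.
Variable alpha : R.
Hypothesis alpha_ltn : (alpha < n%:R)%R.
Notation T := (Rn R n).
Notation posmeas := {measure set T -> \bar R}.
Implicit Types mu nu tau : posmeas.

Lemma concentrated_setC A mu : measurable A -> concentrated A mu -> mu (~` A) = 0.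
Proof.
move=> mA [B [mB B0 AB]]; apply: (subset_measure0 _ mB AB B0).
exact: measurableC.
Qed.

(** Compact subsets of A of large capacity carry unit measures of small energy. *)
Lemma capacity_small_energy A : inner_capacity alpha A = +oo ->
  forall e : R, (0 < e)%R ->
    exists2 tau : posmeas, Eplus1 alpha A tau & energy alpha tau < e%:E.
Proof.
move=> capA e e0.
have : (e^-1)%:E < inner_capacity alpha A by rewrite capA ltry.
move=> /ereal_sup_gt[_ [K [cK KA] <-]]; rewrite /capacity.
set X := [set _ | _ in _] => infX.
have X0 : 0 <= ereal_inf X.
  apply: le_ereal_inf_tmp => _ [mu [[rm _ _] _] <-].
  exact: (mutual_nonneg alpha_ltn).
have : ereal_inf X < e%:E.
  rewrite inve_pgt ?inE ?lee_fin ?invr_ge0 ?(ltW e0)// in infX.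
  by move: infX; rewrite inver invr_eq0 gt_eqF// invrK.
move=> /ereal_inf_lt[_ [mu [[rm Im cm] mK] <-] Ie].
exists mu => //; split.
  split => //.
  by have [B [mB B0 KB]] := cm; exists B; split => // x Ax; apply: KB => Kx; exact/Ax/KA.
have mK' : measurable K by exact: compact_measurable_Rn.
have -> : mu setT = mu K + mu (~` K).
  by rewrite -(setUv K) measureU//; [exact: measurableC|exact: setICr].
by rewrite mK concentrated_setC// adde0.
Qed.

(** For every t > 0, 2 t <tau, nu> <= t^2 I(tau) + I(nu). Choosing t = (I(nu) + 1) / e
    absorbs I(nu), after which I(tau) is taken smaller than e / t. *)
Lemma mutual_small nu : radon alpha nu -> energy alpha nu < +oo ->
  forall e : R, (0 < e)%R -> exists2 d : R, (0 < d)%R &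
    forall tau, radon alpha tau -> energy alpha tau < d%:E ->
      mutual alpha tau nu <= e%:E.
Proof.
move=> rn In e e0.
pose E := fine (energy alpha nu).
have In0 : 0 <= energy alpha nu by exact: (mutual_nonneg alpha_ltn).
have E0 : (0 <= E)%R by rewrite fine_ge0.
pose t := ((E + 1) / e)%R.
have t0 : (0 < t)%R by rewrite divr_gt0// ltr_wpDl.
exists (e / t)%R; first by rewrite divr_gt0.
move=> tau rt It.
have Ioo : energy alpha tau < +oo by exact: lt_trans It (ltry _).
pose tn : {nonneg R} := NngNum (ltW t0).
pose z0 : {nonneg R} := NngNum (lexx (0%R : R)).
have rc := radon_conic tn z0 rt rt.
have := mutual_cs alpha_ltn rn rc.
rewrite (energy_conic alpha_ltn _ _ rt rt Ioo Ioo) (mutual_conicr alpha_ltn _ _ rn rt rt).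
rewrite (mutualC alpha_ltn rn rt).
have m0 := mutual_nonneg alpha_ltn rt rn.
have moo := mutual_lty alpha_ltn rt rn Ioo In.
have I0 : 0 <= energy alpha tau by exact: (mutual_nonneg alpha_ltn).
have fI : energy alpha tau \is a fin_num by rewrite ge0_fin_numE.
have fN : energy alpha nu \is a fin_num by rewrite ge0_fin_numE.
have fm : mutual alpha tau nu \is a fin_num by rewrite ge0_fin_numE.
move: It; rewrite -(fineK fI) -(fineK fm) -(fineK fN) lte_fin => It.
rewrite /= -!(EFinM, EFinD) !lee_fin -/E.
set x := fine (mutual alpha tau nu); set y := fine (energy alpha tau) in It *.
rewrite /= => H.
have tE : (t * e = E + 1)%R by rewrite /t divfK// gt_eqF.
have ty : (t * y < e)%R by rewrite mulrC -ltr_pdivlMr.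
rewrite -(ler_pM2l t0) tE.
have : (t * (t * y) <= t * e)%R by rewrite ler_pM2l// ltW.
rewrite tE; move: H; rewrite expr2; nra.
Qed.

Section external_field.
Variables (A : set T) (om : smeas n alpha).
Let Up := potential alpha (spos om).
Let Un := potential alpha (sneg om).
Let Ut := potential alpha (tvar om).

Lemma radon_tvar : radon alpha (tvar om).
Proof. by apply: radon_add; [exact: spos_radon|exact: sneg_radon]. Qed.

Lemma potential_tvar x : Ut x = Up x + Un x.
Proof.
rewrite /Ut /potential /tvar ge0_integral_measure_add//.
- by move=> y _; exact: kappa_ge0.
- exact: measurable_kappa1.
Qed.

Let mp : measurable_fun setT Up.
Proof. exact: (measurable_potential alpha_ltn (spos_radon om)). Qed.
Let mn : measurable_fun setT Un.
Proof. exact: (measurable_potential alpha_ltn (sneg_radon om)). Qed.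
Let mt : measurable_fun setT Ut.
Proof. exact: (measurable_potential alpha_ltn radon_tvar). Qed.

Let Up0 x : 0 <= Up x. Proof. exact: potential_ge0. Qed.
Let Un0 x : 0 <= Un x. Proof. exact: potential_ge0. Qed.

Let f := fun x => - spotential om x.

Lemma integrable_field tau : \int[tau]_x Ut x < +oo -> tau.-integrable setT f.
Proof.
move=> Uoo; apply/integrableP; split.
  by apply: measurableT_comp => //; exact: emeasurable_funB.
apply: le_lt_trans Uoo; apply: ge0_le_integral => //.
  apply: measurableT_comp => //; apply: measurableT_comp => //.
  exact: emeasurable_funB.
move=> x _; rewrite /f abseN potential_tvar /spotential.
by apply: (le_trans (lee_abs_sub _ _)); rewrite !gee0_abs.
Qed.

(** The bound f <= U^{om^-} holds also where both potentials are infinite: f is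
    +oo there, but so is U^{om^-}. *)
Lemma integral_field_le tau : \int[tau]_x f x <= \int[tau]_x Un x.
Proof.
have mf : measurable_fun setT f.
  by apply: measurableT_comp => //; exact: emeasurable_funB.
rewrite integralE; apply: (@le_trans _ _ (\int[tau]_x f^\+ x)).
  by rewrite geeDl// oppe_le0 integral_ge0.
apply: ge0_le_integral => //.
  exact: measurable_funepos.
move=> x _; rewrite funeposE ge_max Un0 andbT /f /spotential.
rewrite -/(Up x) -/(Un x).
have := Up0 x; have := Un0 x.
case: (Up x) => [a||]; case: (Un x) => [b||]//=; rewrite ?leey ?leNye//.
by rewrite !lee_fin; lra.
Qed.

Lemma bounded_potential : ereal_sup [set Ut x | x in A] < +oo ->
  exists2 m : R, (0 <= m)%R & forall x, A x -> Ut x <= m%:E.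
Proof.
move=> sup_lty.
have ub x : A x -> Ut x <= ereal_sup [set Ut x | x in A].
  by move=> Ax; apply: ereal_sup_ubound; exists x.
case: (ereal_sup _) sup_lty ub => [r| |]// _ ub.
- exists (Num.max r 0%R); first by rewrite le_max lexx orbT.
  by move=> x /ub /le_trans; apply; rewrite lee_fin le_max lexx.
- by exists 0%R => // x /ub /le_trans; apply; rewrite leNye.
Qed.

Lemma enorm_sub_le (x y : 'rV[R]_n) (M : R) : (enorm x <= M)%R -> (enorm y <= M)%R ->
  (enorm (x - y) <= 2 * M)%R.
Proof.
move=> xM yM.
have M0 : (0 <= M)%R by apply: le_trans xM; exact: sqrtr_ge0.
have sq (z : 'rV[R]_n) : (\sum_(i < n) z ord0 i ^+ 2 = enorm z ^+ 2)%R.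
  by rewrite sqr_sqrtr// sumr_ge0// => i _; exact: sqr_ge0.
rewrite -ler_sqr ?nnegrE ?sqrtr_ge0 ?mulr_ge0// -sq.
apply: (@le_trans _ _ (2 * enorm x ^+ 2 + 2 * enorm y ^+ 2)%R).
  rewrite -!sq !mulr_sumr -big_split/=; apply: ler_sum => i _; rewrite !mxE.
  by have := sqr_ge0 (x ord0 i + y ord0 i)%R; lra.
have : (enorm x ^+ 2 <= M ^+ 2)%R by rewrite ler_sqr ?nnegrE ?sqrtr_ge0.
have : (enorm y ^+ 2 <= M ^+ 2)%R by rewrite ler_sqr ?nnegrE ?sqrtr_ge0.
by lra.
Qed.

(** In case (i) this is the finiteness of a mutual energy; in case (ii) the
    potential is bounded on A and tau has mass 1. *)
Lemma tvar_integral_lty tau : finite_energy om \/ bounded_case om A ->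
  Eplus1 alpha A tau -> \int[tau]_x Ut x < +oo.
Proof.
move=> om_cases [[rt It ct] tau1].
have [Iom|[_ _ sup_lty _]] := om_cases.
  rewrite -mutualE//; last exact: radon_tvar.
  by apply: mutual_lty => //; exact: radon_tvar.
have [m m0 mP] := bounded_potential sup_lty.
apply: (@le_lt_trans _ _ (\int[tau]_x (cst m%:E) x)).
  apply: ae_ge0_le_integral => //.
  - by move=> x _; exact: potential_ge0.
  - by have [B [mB B0 AB]] := ct; exists B; split => // x /=; move/not_implyP => [_ h];
      apply: AB => Ax; exact/h/mP.
by rewrite integral_cst// tau1 mule1 ltry.
Qed.

(** On a ball the kernel is bounded below by some c > 0, whence
    c tau(B)^2 <= I(tau). *)
Lemma ball_mass_small (M e : R) : (0 < e)%R -> exists2 d : R, (0 < d)%R &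
  forall tau, radon alpha tau -> tau setT = 1 -> energy alpha tau < d%:E ->
    tau [set x : T | (enorm x <= M)%R] <= e%:E.
Proof.
move=> e0.
(* The maximum with 1 keeps the base of the power positive when M <= 0. *)
pose L := Num.max (2 * M)%R 1%R.
have L0 : (0 < L)%R by rewrite lt_max ltr01 orbT.
pose c := (L `^ (alpha - n%:R))%R.
have c0 : (0 < c)%R by rewrite powR_gt0.
exists (c * e ^+ 2)%R; first by rewrite mulr_gt0// exprn_gt0.
move=> tau rt tau1 It.
pose B := [set x : T | (enorm x <= M)%R].
have mB : measurable B by exact: measurable_enorm_le.
have kB x y : B x -> B y -> c%:E <= kappa alpha x y.
  move=> Bx By; rewrite /kappa; case: eqP => [_|/eqP xy]; first by rewrite leey.
  have E0 : (0 < enorm ((x : 'rV[R]_n) - y))%R.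
    rewrite /enorm sqrtr_gt0 lt_neqAle eq_sym; apply/andP; split.
      rewrite (_ : (\sum_(i < n) _)%R = sqdist x y); first by rewrite sqdist_eq0.
      by apply: eq_bigr => i _; rewrite !mxE.
    by apply: sumr_ge0 => i _; exact: sqr_ge0.
  have EL : (enorm ((x : 'rV[R]_n) - y) <= L)%R.
    by rewrite le_max (@enorm_sub_le x y M).
  rewrite lee_fin /c -(opprB n%:R alpha) !powRN lef_pV2 ?posrE ?powR_gt0//.
  apply: ge0_ler_powR => //; rewrite ?nnegrE; last 2 first.
  - exact: ltW.
  - exact: ltW.
  by rewrite subr_ge0 ltW.
have tB1 : tau B <= 1 by rewrite -tau1 le_measure// inE.
have tBfin : tau B \is a fin_num by rewrite ge0_fin_numE// (le_lt_trans tB1)// ltry.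
have : c%:E * tau B * tau B <= energy alpha tau.
  rewrite /energy mutualE//.
  rewrite -integral_cst//.
  apply: (@le_trans _ _ (\int[tau]_(x in B) potential alpha tau x)).
    apply: ge0_le_integral => //.
    - by move=> x _; rewrite mule_ge0// lee_fin ltW.
    - by apply: measurable_funTS; exact: measurable_potential.
    - move=> x Bx; rewrite -integral_cst//.
      apply: (@le_trans _ _ (\int[tau]_(y in B) kappa alpha x y)).
        apply: ge0_le_integral => //.
        + by move=> y _; rewrite lee_fin ltW.
        + by apply: measurable_funTS; exact: measurable_kappa1.
        + by move=> y By; exact: kB.
      apply: ge0_subset_integral => //; first exact: measurable_kappa1.
      by move=> y _; exact: kappa_ge0.
  apply: ge0_subset_integral => //; first exact: measurable_potential.
  by move=> x _; exact: potential_ge0.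
move=> /le_lt_trans /(_ It); rewrite -/B -(fineK tBfin) -!EFinM lte_fin lee_fin.
rewrite -mulrA ltr_pM2l// -expr2 => h.
rewrite leNgt; apply/negP => /ltW he; move: h.
by rewrite ltNge lerXn2r ?nnegrE// ?ltW// fine_ge0.
Qed.

(** In case (ii), with m a bound for the potential on A and M a radius beyond which
    it is at most e / 2, the integral is at most m tau(B_M) + e / 2. *)
Lemma sneg_integral_small : finite_energy om \/ bounded_case om A ->
  forall e : R, (0 < e)%R -> exists2 d : R, (0 < d)%R &
    forall tau, Eplus1 alpha A tau -> energy alpha tau < d%:E ->
      \int[tau]_x Un x <= e%:E.
Proof.
move=> om_cases e e0.
have [Iom|[_ _ sup_lty lim0]] := om_cases.
  have [d d0 dP] := mutual_small radon_tvar Iom e0.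
  exists d => // tau [[rt It ct] tau1] Id.
  apply: le_trans (dP _ rt Id); rewrite mutualE//; last exact: radon_tvar.
  apply: ge0_le_integral => //.
  by move=> x _; rewrite -/(Ut x) potential_tvar leeDr.
have [m m0 mP] := bounded_potential sup_lty.
have [M MP] : exists M : R, forall x, closure A x -> (M < enorm x)%R ->
    Un x <= (e / 2)%:E.
  have e2 : (0 < e / 2)%R by rewrite divr_gt0.
  have /lim0[M _ MP] : nbhs (0 : \bar R) [set y | y < (e / 2)%:E].
    by apply: open_nbhs_nbhs; split; [exact: open_ereal_lt_ereal|rewrite /= lte_fin].
  by exists M => x cx Mx; exact/ltW/(MP x Mx cx).
pose e' := (e / 2 / (m + 1))%R.
have e'0 : (0 < e')%R by rewrite !divr_gt0// ltr_wpDl.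
have [d d0 dP] := ball_mass_small M e'0.
exists d => // tau [[rt It ct] tau1] Id.
pose B := [set x : T | (enorm x <= M)%R].
have mB : measurable B by exact: measurable_enorm_le.
have tB := dP _ rt tau1 Id.
apply: (@le_trans _ _ (\int[tau]_x (m%:E * (\1_B x)%:E + (e / 2)%:E))).
  apply: ae_ge0_le_integral => //.
  - move=> x _; apply: adde_ge0; last by rewrite lee_fin divr_ge0// ltW.
    by rewrite mule_ge0.
  - apply: emeasurable_funD => //; apply: measurable_funeM.
    by apply/measurable_EFinP; exact: measurable_indic.
  - have [D [mD D0 AD]] := ct; exists D; split => // x /=; move/not_implyP => [_ h].
    apply: AD => Ax; apply: h.
    rewrite indicE; have [xB|xB] := boolP (x \in B).
      rewrite mule1; apply: (@le_trans _ _ m%:E); last first.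
        by rewrite leeDl// lee_fin divr_ge0 ?ltW.
      apply: le_trans (mP _ Ax).
      by rewrite -/(Ut x) potential_tvar leeDr.
    rewrite mule0 add0e; apply: MP; first exact: subset_closure.
    by move: xB; rewrite notin_setE /B/= => /negP; rewrite -ltNge.
rewrite ge0_integralD//; last 3 first.
- by move=> x _; rewrite -EFinM lee_fin mulr_ge0.
- by apply: measurable_funeM; apply/measurable_EFinP; exact: measurable_indic.
- by move=> x _; rewrite lee_fin divr_ge0 ?ltW.
rewrite integral_cst// tau1 mule1 ge0_integralZl//; last first.
  by apply/measurable_EFinP; exact: measurable_indic.
rewrite integral_indic// setIT.
rewrite [leRHS](_ : _ = (e / 2)%:E + (e / 2)%:E); last by rewrite -EFinD -splitr.
apply: leeD => //; apply: (@le_trans _ _ (m%:E * e'%:E)).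
  by rewrite lee_wpmul2l// lee_fin.
rewrite -EFinM lee_fin /e' mulrA ler_pdivrMr ?ltr_wpDl// mulrC ler_wpM2l ?divr_ge0 ?ltW//.
by rewrite ltrDl.
Qed.

End external_field.

Section no_minimizer.
Variables (A : set T) (om : smeas n alpha) (hom mu : posmeas).
Let f := fun x => - spotential om x.

(** If the mass were smaller than 1, the two minimizers would have the same value
    of I_f, hence coincide in energy norm, which forces equal masses. *)
Lemma balayage_mass_ge1 :
  inner_capacity alpha A = +oo -> finite_energy om \/ bounded_case om A ->
  pseudo_balayage om A hom -> minimizer (gauss alpha f) (Eplus1 alpha A) mu ->
  1 <= hom setT.
Proof.
move=> capA om_cases [[[rh Ih ch] fh] hmin] [[[rm Im cm] m1] mmin].
rewrite leNgt; apply/negP => hom_lt1.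
have f_int tau : Eplus1 alpha A tau -> tau.-integrable setT f.
  by move=> h; apply: integrable_field; exact: tvar_integral_lty h.
have fm : mu.-integrable setT f by exact: f_int.
have hfin : hom setT \is a fin_num.
  by rewrite ge0_fin_numE// (lt_trans hom_lt1)// ltry.
pose h := fine (hom setT).
have hE : hom setT = h%:E by rewrite fineK.
have h1 : (h < 1)%R by rewrite -lte_fin -hE.
have h0 : (0 <= h)%R by rewrite fine_ge0.
have c0 : (0 <= 1 - h)%R by rewrite subr_ge0 ltW.
pose c : {nonneg R} := NngNum c0.
pose i : {nonneg R} := NngNum (ler01 : 0 <= 1 :> R)%R.
have half0 : (0 <= 2^-1 :> R)%R by rewrite invr_ge0.
pose half : {nonneg R} := NngNum half0.
pose IM := fine (energy alpha mu); pose IH := fine (energy alpha hom).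
pose FM := fine (\int[mu]_x f x); pose FH := fine (\int[hom]_x f x).
pose X := fine (mutual alpha mu hom).
(* Compare with hom + c tau, where c = 1 - h. The error terms 2 c <hom, tau>,
   c^2 I(tau) and 2 c int f dtau add up to at most 2 e / 5 + e / 5 + 2 e / 5. *)
have mu_le : (IM + 2 * FM <= IH + 2 * FH)%R.
  apply/ler_addgt0Pr => e e0.
  have e5 : (0 < e / 5)%R by rewrite divr_gt0.
  have [d1 d1_0 d1P] := mutual_small rh Ih e5.
  have [d2 d2_0 d2P] := sneg_integral_small om_cases e5.
  have dm0 : (0 < Num.min (e / 5) (Num.min d1 d2))%R by rewrite !lt_min e5 d1_0.
  have [tau Etau Id] := capacity_small_energy capA dm0.
  have Ie : energy alpha tau < (e / 5)%:E.
    by apply: lt_le_trans Id _; rewrite lee_fin ge_min lexx.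
  have I1 : energy alpha tau < d1%:E.
    by apply: lt_le_trans Id _; rewrite lee_fin !ge_min lexx orbT.
  have I2 : energy alpha tau < d2%:E.
    by apply: lt_le_trans Id _; rewrite lee_fin !ge_min lexx !orbT.
  have ft := f_int _ Etau.
  have Et := Etau; case: Et => -[rt It ct] t1.
  have Ftau : (fine (\int[tau]_x f x) <= e / 5)%R.
    rewrite -lee_fin fineK; last exact: integrable_fin_num.
    exact: le_trans (integral_field_le om tau) (d2P _ Etau I2).
  have Xtau : (0 <= fine (mutual alpha hom tau) <= e / 5)%R.
    have mt := mutual_nonneg alpha_ltn rh rt.
    rewrite fine_ge0//= -lee_fin fineK; last first.
      by rewrite ge0_fin_numE//; exact: mutual_lty.
    by rewrite mutualC// d1P.
  have Itau : (0 <= fine (energy alpha tau) <= e / 5)%R.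
    have mt := mutual_nonneg alpha_ltn rt rt.
    by rewrite fine_ge0//= -lee_fin fineK ?ltW// ge0_fin_numE.
  have : gauss alpha f mu <= gauss alpha f (conic i c hom tau).
    apply: mmin; split; first exact: Eplus_conic.
    by rewrite conicE hE t1 /= -!EFinM -EFinD mul1r mulr1 addrCA subrr addr0.
  rewrite gaussE// gauss_conic// lee_fin -/IM -/FM -/IH -/FH /=.
  move: Ftau Xtau Itau; set a := fine _; set b := fine _; set g := fine _.
  move=> ae /andP[b0 be] /andP[g0 ge] H.
  have cb : ((1 - h) * b <= b)%R by rewrite ler_piMl// gerBl.
  have cg : ((1 - h) ^+ 2 * g <= g)%R by rewrite ler_piMl// exprn_ile1// gerBl.
  have ca : ((1 - h) * a <= e / 5)%R.
    have [a0|/ltW a0] := leP 0%R a.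
      by apply: le_trans ae; rewrite ler_piMl// gerBl.
    by apply: le_trans (ltW e5); rewrite mulr_ge0_le0.
  move: H; rewrite expr1n !mul1r !mulr1; lra.
(* The midpoint is admissible for the balayage problem. *)
have : gauss alpha f hom <= gauss alpha f (conic half half mu hom).
  by apply: hmin; split; [exact: Eplus_conic|exact: integrable_conic].
rewrite gaussE// gauss_conic// lee_fin -/IM -/FM -/IH -/FH -/X /= => mid.
have : 2%:E * mutual alpha mu hom < energy alpha mu + energy alpha hom.
  apply: mutual_strict => //.
  - by rewrite m1 ltry.
  - by rewrite hE ltry.
  - by rewrite m1 hE eqe gt_eqF.
have fI nu : radon alpha nu -> energy alpha nu < +oo ->
    energy alpha nu = (fine (energy alpha nu))%:E.
  by move=> rnu Inu; rewrite fineK// ge0_fin_numE//; exact: mutual_nonneg.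
rewrite (fI _ rm Im) (fI _ rh Ih) -/IM -/IH.
have -> : mutual alpha mu hom = X%:E.
  rewrite fineK// ge0_fin_numE; first exact: mutual_lty.
  exact: mutual_nonneg.
rewrite -EFinM -EFinD lte_fin.
move: mid mu_le; lra.
Qed.

End no_minimizer.
End small_energy.

(** * Nonexistence of the minimizer *)

Theorem theorem6p4 (R : realType) (n : nat) (alpha : R)
    (n_ge2 : (2 <= n)%N) (alpha_gt0 : (0 < alpha)%R)
    (alpha_ltn : (alpha < n%:R)%R)
    (A : set (Rn R n))
    (capA : inner_capacity alpha A = +oo)
    (closedA : strongly_closed alpha (Eplus alpha A))
    (om : smeas n alpha)
    (om_cases : finite_energy om \/ bounded_case om A)
    (hom : {measure set (Rn R n) -> \bar R})
    (hom_balayage : pseudo_balayage om A hom)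
    (hom_lt1 : hom setT < 1) :
  ~ exists mu : {measure set (Rn R n) -> \bar R},
      minimizer (gauss alpha (fun x => - spotential om x)) (Eplus1 alpha A) mu.
Proof.
move=> [mu mu_min]; move: hom_lt1; apply/negP; rewrite -leNgt.
exact: (balayage_mass_ge1 alpha_ltn capA om_cases hom_balayage mu_min).
Qed.
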